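(* Let $F=F(X)$ be in $L^2(P)$ with mean zero. Then $$d_W(F,N)\leq \sqrt{\tfrac{2}{\pi}}\,E|1-Z|+2E\left[\sum_{i=1}^{\infty}(\mathfrak{d}_iF)^2\,\big|E[\mathfrak{D}_iF|\mathcal{F}_i]\big|\right]$$ and the right-hand side is in turn bounded by $$\sqrt{\tfrac{2}{\pi}}\,\big|1-E[F^2]\big|+\sqrt{\tfrac{2}{\pi}}\sqrt{\mathrm{Var}(Z)}+2\mathcal{L}_3(F),$$ where $$Z:=\sum_{i=1}^{\infty}\mathfrak{D}_iF\,E[\mathfrak{D}_iF|\mathcal{F}_i].$$
   Context: $X=(X_1,X_2,\dots)$ is a sequence of independent random variables (not necessarily identically distributed) on a probability space $(\Omega,\mathfrak{F},P)$ with values in a measurable space $\mathcal{X}$. $F=F(X)$ means that $F$ is a real-valued measurable function of the sequence $X$. $X'=(X_1',X_2',\dots)$ is an independent copy of $X$, and $T_iF=F(X_1,\dots,X_{i-1},X_i',X_{i+1},\dots)$ for $i\ge1$. $E_i$ and $E_i'$ denote the expectations with respect to $X_i$ and $X_i'$, respectively; in particular $E_i[F]=E[F|\sigma(X_k,k\neq i)]$. Difference operators: $\mathfrak{D}_iF=F-E_i[F]$ for $F\in L^1(P)$, and $\mathfrak{d}_iF=\big(\tfrac12E_i'|F-T_iF|^2\big)^{1/2}$ for $F\in L^2(P)$, $i\ge1$. $\mathcal{F}_i=\sigma(X_k,k\le i)$ for $i\ge1$. Generalized Lyapunov ratio: $\mathcal{L}_r(F):=\sum_{i=1}^\infty E|\mathfrak{D}_iF|^r$,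 $r>0$. $N$ is a standard normal random variable. $d_W(F,N):=\sup|E[h(F)]-E[h(N)]|$, the supremum over all $h:\mathbb{R}\to\mathbb{R}$ with $|h(x)-h(y)|\le|x-y|$.
   Formalization: The series defining Z need not converge for every F in L²(P); the formal theorem assumes that it converges in L¹(P) and takes Z to be its L¹(P) sum. *)

(* Defs.v *)
From HB Require Import structures.
From mathcomp Require Import all_boot all_order all_algebra finmap.
From mathcomp Require Import all_classical all_reals all_analysis.

Set Implicit Arguments.
Unset Strict Implicit.
Unset Printing Implicit Defensive.

Import Order.TTheory GRing.Theory Num.Theory.
Import numFieldNormedType.Exports.

Local Open Scope classical_set_scope.
Local Open Scope ring_scope.
Local Open Scope ereal_scope.

(* Sequences are indexed from 0: [X k] stands for X_(k+1). *)

(* Generating system of the sigma-algebra sigma(X_k, k in K); the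
   sigma-algebra itself is carried by [g_sigma_algebraType (gen_sigma X K)]. *)
Definition gen_sigma (T : Type) (d' : measure_display) (S : measurableType d')
    (X : nat -> T -> S) (K : set nat) : set (set T) :=
  \bigcup_(k in K) preimage_set_system setT (X k) measurable.

(* S^nat with its product sigma-algebra, generated by the coordinates. *)
Definition seq_space (d' : measure_display) (S : measurableType d') :=
  g_sigma_algebraType (gen_sigma (fun k (x : nat -> S) => x k) setT).

Definition mutually_independent (d d' : measure_display) (R : realType)
    (T : measurableType d) (S : measurableType d') (P : probability T R)
    (X : nat -> T -> S) : Prop :=
  forall (J : {fset nat}) (A : nat -> set S), (forall k, measurable (A k)) ->
    P (\bigcap_(k in [set` J]) X k @^-1` A k)
    = \prod_(k <- J) P (X k @^-1` A k).

(* [Z] is a version of E[Y | <<s G >>]. *)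
Definition is_cond_exp (d : measure_display) (R : realType)
    (T : measurableType d) (P : probability T R) (G : set (set T))
    (Y Z : T -> R) : Prop :=
  [/\ measurable_fun [set: g_sigma_algebraType G]
        (Z : g_sigma_algebraType G -> R),
      P.-integrable setT (EFin \o Z) &
      forall A, G.-sigma.-measurable A ->
        \int[P]_(w in A) (Z w)%:E = \int[P]_(w in A) (Y w)%:E].

Section functionals.
Context (d d' : measure_display) (R : realType) (T : measurableType d)
  (S : measurableType d') (P : probability T R).
Implicit Types (X : nat -> T -> S) (f : (nat -> S) -> R) (i : nat).

Definition functional f X : T -> R := fun w => f (fun k => X k w).

(* The independent copy X' of X is realised on the second factor of
   (T * T, P \x P), as X'(w, w') := X(w'); hence T_i F is a function of the
   pair (w, w'), and E_i' is the P-integral with respect to w'. *)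
Definition resampled f X i (w w' : T) : R :=
  f (fun k => if k == i then X k w' else X k w).

Definition frakd f X i (w : T) : \bar R :=
  sqrte ((2^-1)%:E *
    \int[P]_w' ((`|functional f X w - resampled f X i w w'| ^+ 2)%R)%:E).

(* [D] is a version of F - E_i[F], where E_i[F] = E[F | sigma(X_k, k <> i)]. *)
Definition is_frakD X (F : T -> R) i (D : T -> R) : Prop :=
  exists2 EiF : T -> R,
    is_cond_exp P (gen_sigma X [set k | k != i]) F EiF & D = (F \- EiF)%R.

Definition lyapunov_ratio (r : R) (D : nat -> T -> R) : \bar R :=
  \sum_(0 <= i <oo) 'E_P[(fun w => `|D i w| `^ r)%R].

(* The series defining Z need not converge almost surely for F in L^2, and
   almost sure convergence would not give E[Z] = E[F^2]; the sum is therefore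
   taken in L^1(P). *)
Definition L1_sum (u : nat -> T -> R) (Z : T -> R) : Prop :=
  'E_P[(fun w => `|\sum_(0 <= i < n) u i w - Z w|)%R] @[n --> \oo] --> 0.

End functionals.

Definition wasserstein (d d'' : measure_display) (R : realType)
    (T : measurableType d) (U : measurableType d'') (P : probability T R)
    (Q : probability U R) (F : T -> R) (N : U -> R) : \bar R :=
  ereal_sup [set `|'E_P[h \o F] - 'E_Q[h \o N]| | h in
    [set h : R -> R | forall x y, (`|h x - h y| <= `|x - y|)%R]].

(* Main.v *)
(* Stein's equation g'(x) - x g(x) = h(x) - E h(N) turns the distance into
   E[g'(F)] - E[F g(F)], where |g'| <= sqrt (2 / pi) and g' is 2-Lipschitz.
   Let M_i = E[D_i F | F_i]. By independence the M_i are the martingale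
   differences of F along the filtration (F_i), so E[F g(F)] is the sum of the
   E[M_i g(F)]; moreover M_i is orthogonal to g(T_i F), and
   E[M_i D_i F g'(F)] = E[M_i (F - T_i F) g'(F)]. A first-order Taylor expansion
   of g at F therefore leaves an error of at most E[|M_i| (F - T_i F)^2] in each
   term, while the main terms add up to E[Z g'(F)].
   Conditional expectations are computed by integrating an independent copy of
   the sequence over the coordinates outside a set K; everything about them
   follows from the invariance of the law of the pair of copies under the
   exchange of any set of coordinates. *)
From HB Require Import structures.
Require Import Defs.
From mathcomp Require Import all_boot all_order all_algebra finmap.
From mathcomp Require Import all_classical all_reals all_analysis.
From mathcomp Require Import measurable_realfun ring lra.

Set Implicit Arguments.
Unset Strict Implicit.
Unset Printing Implicit Defensive.

Import Order.TTheory GRing.Theory Num.Theory.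
Import numFieldNormedType.Exports.

Local Open Scope classical_set_scope.
Local Open Scope ring_scope.

(** Two features of the statement shape the proof. The [D i] and [M i] are arbitrary versions of
    conditional expectations on [T], whereas the argument evaluates D_i F at a resampled sequence
    and exchanges coordinates under conditional expectations; they are therefore identified almost
    surely with integrals over a second copy ([Dtil], [mdiff], [EK]), which are defined everywhere.
    And [Z] is only an L^1 limit, so it can be paired with bounded functions such as g'(F), but not
    with g(F). On the other side, the sum of E[M_i g(F)] over i < n is E[E[F | X_k, k < n] g(F)];
    its limit comes from the density of simple functions in L^1 and a truncation of g(F), not from a
    martingale convergence theorem. Constants: sqrt (2 / pi) is twice the normal density at 0. As g'
    is 2-Lipschitz, the Taylor error is exactly (y - x)^2, and the factor 2 before the sum comes
    from E_i'(F - T_i F)^2 = 2 (d_i F)^2. Var(Z) and the third moments may be infinite, so the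
    bounds that involve them live in the extended reals. *)

Section real_integrable.
Context d (T : measurableType d) (R : realType) (mu : {measure set T -> \bar R}).
Variables (D : set T) (mD : measurable D).
Implicit Types f g : T -> R.

Lemma integrable_realZ k f : mu.-integrable D (EFin \o f) ->
  mu.-integrable D (EFin \o (fun x => k * f x)).
Proof. by move=> fi; exact: (integrableZl mD k fi). Qed.

Lemma integrable_realD f g : mu.-integrable D (EFin \o f) ->
  mu.-integrable D (EFin \o g) ->
  mu.-integrable D (EFin \o (fun x => f x + g x)).
Proof. by move=> fi gi; exact: (integrableD mD fi gi). Qed.

Lemma integrable_realB f g : mu.-integrable D (EFin \o f) ->
  mu.-integrable D (EFin \o g) ->
  mu.-integrable D (EFin \o (fun x => f x - g x)).
Proof. by move=> fi gi; exact: (integrableB mD fi gi). Qed.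

Lemma le_integrable_real f g : measurable_fun D f ->
  (forall x, D x -> `|f x| <= g x) -> mu.-integrable D (EFin \o g) ->
  mu.-integrable D (EFin \o f).
Proof.
move=> mf fg; apply: le_integrable => //; first exact/measurable_EFinP.
by move=> x Dx; rewrite lee_fin (le_trans (fg _ Dx))// ler_norm.
Qed.

Lemma integrable_measurable_real f : mu.-integrable D (EFin \o f) ->
  measurable_fun D f.
Proof. by move=> /measurable_int/measurable_EFinP. Qed.

Lemma EFin_Rintegral f : mu.-integrable D (EFin \o f) ->
  (\int[mu]_(x in D) (f x)%:E = (\int[mu]_(x in D) f x)%:E)%E.
Proof. by move=> fi; rewrite /Rintegral fineK//; exact: integrable_fin_num. Qed.

Lemma ae_eq_Rintegral f g : measurable_fun D f -> measurable_fun D g ->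
  {ae mu, forall x, D x -> f x = g x} ->
  \int[mu]_(x in D) f x = \int[mu]_(x in D) g x.
Proof.
move=> mf mg fg; congr fine; apply: ae_eq_integral => //.
- exact/measurable_EFinP.
- exact/measurable_EFinP.
- by apply: filterS fg => x h Dx /=; rewrite h.
Qed.

Lemma ae_eq_integrable_real f g : measurable_fun D f -> measurable_fun D g ->
  {ae mu, forall x, D x -> f x = g x} ->
  mu.-integrable D (EFin \o f) -> mu.-integrable D (EFin \o g).
Proof.
move=> mf mg fg /integrableP[_ fi]; apply/integrableP; split; first exact/measurable_EFinP.
have <- : (\int[mu]_(x in D) `|(EFin \o f) x| = \int[mu]_(x in D) `|(EFin \o g) x|)%E.
  apply: ae_eq_integral => //.
  - by apply: measurableT_comp => //; exact/measurable_EFinP.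
  - by apply: measurableT_comp => //; exact/measurable_EFinP.
  - by apply: filterS fg => x h Dx /=; rewrite h.
by [].
Qed.

End real_integrable.

(** * The Gaussian Stein equation *)

Section derive_lambda.
Context {R : realType}.
Implicit Types (f g : R -> R) (x a b : R).

Lemma is_derive_cstE x c : is_derive x 1 (fun=> c : R) 0.
Proof. exact: is_derive_cst. Qed.

Lemma is_derive_idE x : is_derive x (1 : R) (fun y : R => y) 1.
Proof. exact: is_derive_id. Qed.

Lemma is_derive_oppE x : is_derive x 1 (@GRing.opp R) (- 1).
Proof. exact: is_deriveNid. Qed.

Lemma is_deriveDE f g x a b : is_derive x 1 f a -> is_derive x 1 g b ->
  is_derive x 1 (fun y => f y + g y) (a + b).
Proof. by move=> ? ?; exact: is_deriveD. Qed.

Lemma is_deriveNE f x a : is_derive x 1 f a ->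
  is_derive x 1 (fun y => - f y) (- a).
Proof. by move=> ?; exact: is_deriveN. Qed.

Lemma is_deriveME f g x a b : is_derive x 1 f a -> is_derive x 1 g b ->
  is_derive x 1 (fun y => f y * g y) (a * g x + f x * b).
Proof.
move=> fa gb; apply: is_derive_eq (is_deriveM fa gb) _.
by rewrite /GRing.scale /=; ring.
Qed.

Lemma is_deriveXE f n x a : is_derive x 1 f a ->
  is_derive x 1 (fun y => f y ^+ n) (n%:R * f x ^+ n.-1 * a).
Proof.
move=> fa; have -> : (fun y => f y ^+ n) = f ^+ n by rewrite exprfctE.
exact: is_deriveX.
Qed.

Lemma is_deriveVE f x a : f x != 0 -> is_derive x 1 f a ->
  is_derive x 1 (fun y => (f y)^-1) (- a / f x ^+ 2).
Proof.
move=> fx fa; apply: is_derive_eq (is_deriveV fx fa) _.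
by rewrite /GRing.scale /=; field.
Qed.

Lemma is_derive_continuous f x a : is_derive x 1 f a -> {for x, continuous f}.
Proof.
by move=> [d _]; apply: differentiable_continuous; apply/derivable1_diffP.
Qed.

Lemma is_derive_expRE f x a : is_derive x 1 f a ->
  is_derive x 1 (fun y => expR (f y)) (a * expR (f x)).
Proof.
by move=> fa; rewrite mulrC; exact: is_derive1_comp.
Qed.

Lemma MVT_real f df a b : a < b -> (forall x, is_derive x 1 f (df x)) ->
  exists2 c, c \in `]a, b[ & f b - f a = df c * (b - a).
Proof.
move=> ab fdf; apply: MVT => // x.
by apply: continuous_subspaceT => y; exact: is_derive_continuous (fdf y).
Qed.

End derive_lambda.

Ltac derive_step := match goal with
  | |- is_derive _ _ (fun _ => ?c) _ => eapply is_derive_cstE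
  | |- is_derive _ _ (fun _ => _ + _) _ => eapply is_deriveDE
  | |- is_derive _ _ -%R _ => eapply is_derive_oppE
  | |- is_derive _ _ (fun _ => - _) _ => eapply is_deriveNE
  | |- is_derive _ _ (fun _ => _ * _) _ => eapply is_deriveME
  | |- is_derive _ _ (fun _ => _ ^+ _) _ => eapply is_deriveXE
  | |- is_derive _ _ (fun _ => _^-1) _ => eapply is_deriveVE
  | |- is_derive _ _ (fun _ => expR _) _ => eapply is_derive_expRE
  | |- is_derive _ _ (fun x => x) _ => eapply is_derive_idE
  | |- is_derive _ _ _ _ => solve [eauto with derive_db]
  end.
Ltac derive_all := eapply is_derive_eq; [repeat derive_step|rewrite /=].
Create HintDb derive_db.

(** * The Gaussian density, distribution function and partial moments *)

Section gauss.
Context {R : realType}.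
Local Notation mu := (@lebesgue_measure R).

Definition gphi : R -> R := normal_pdf 0 1.
Definition gPhi (x : R) : R := \int[mu]_(t in `]-oo, x]) gphi t.

Lemma gphiE x : gphi x = gphi 0 * expR (- x ^+ 2 / 2).
Proof.
rewrite /gphi normal_pdfE ?oner_neq0// /normal_fun !subr0 expr1n expr0n/=.
by rewrite oppr0 mul0r expR0 mulr1.
Qed.

Lemma gphi0E : gphi 0 = (Num.sqrt (2 * pi))^-1.
Proof.
rewrite /gphi normal_pdfE ?oner_neq0// /normal_fun !subr0 /normal_peak.
by rewrite expr1n expr0n/= oppr0 mul0r expR0 mulr1 mul1r -mulr_natl.
Qed.

Lemma gphi_gt0 x : 0 < gphi x.
Proof.
rewrite gphiE mulr_gt0 ?expR_gt0// gphi0E invr_gt0 sqrtr_gt0.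
by rewrite mulr_gt0// pi_gt0.
Qed.

Lemma gphi_neq0 x : gphi x != 0. Proof. by rewrite gt_eqF ?gphi_gt0. Qed.

Lemma gphiN x : gphi (- x) = gphi x.
Proof. by rewrite gphiE sqrrN -gphiE. Qed.

(** From exp(t) >= 1 + t at t = x^2 / 2; the limits at infinity rest on this rational decay. *)
Lemma gphi_le x : gphi x <= gphi 0 / (1 + x ^+ 2 / 2).
Proof.
rewrite gphiE ler_pM2l ?gphi_gt0// mulNr expRN lef_pV2 ?posrE ?expR_gt0//.
  exact: expR_ge1Dx.
by have := sqr_ge0 x; lra.
Qed.

Lemma is_derive_gphi x : is_derive x (1 : R) gphi (- x * gphi x).
Proof.
have -> : gphi = (fun y => gphi 0 * expR (- (y * y) / 2)).
  by apply/funext => y; rewrite gphiE expr2.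
derive_all.
by field.
Qed.

Hint Resolve is_derive_gphi : derive_db.

Lemma continuous_gphi : continuous gphi.
Proof. by move=> x; exact: is_derive_continuous (is_derive_gphi x). Qed.

Lemma integrable_gphi : mu.-integrable setT (EFin \o gphi).
Proof. exact: integrable_normal_pdf. Qed.

(** The identity as a random variable under the standard normal law: [gPhi] is its [cdf], which
    yields the limit 1 at infinity. *)
Let idTR : measurableTypeR R -> R := idfun.
#[local] HB.instance Definition _ :=
  @isMeasurableFun.Build _ _ _ _ idTR (@measurable_id _ _ setT).

Opaque gphi.

Lemma gPhi_cdf x : (gPhi x)%:E = cdf (idTR : {RV (normal_prob 0 1) >-> R}) x.
Proof.
rewrite /cdf /distribution /pushforward/= /normal_prob /gPhi /Rintegral fineK//.
apply: integrable_fin_num => //.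
by apply: integrableS integrable_gphi.
Qed.

Lemma gPhi_le1 x : gPhi x <= 1.
Proof. by rewrite -lee_fin gPhi_cdf cdf_le1. Qed.

Lemma cvg_gPhiy : gPhi x @[x --> +oo] --> (1 : R).
Proof.
apply: (@fine_cvg _ _ _ _ (EFin \o gPhi)).
have -> : EFin \o gPhi = cdf (idTR : {RV (normal_prob 0 1) >-> R}).
  by apply/funext => x; rewrite /= gPhi_cdf.
exact: cvg_cdfy1.
Qed.

Lemma is_derive_gPhi x : is_derive x (1 : R) gPhi (gphi x).
Proof.
have xx1 : x < x + 1 by rewrite ltrDl.
have iphi : mu.-integrable `]-oo, x + 1] (EFin \o gphi).
  by apply: integrableS integrable_gphi.
have [||d e] := continuous_FTC1 xx1 iphi.
- by rewrite ltNyr.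
- exact: continuous_gphi.
- by apply: DeriveDef; [exact: d|rewrite -derive1E; exact: e].
Qed.

Hint Resolve is_derive_gPhi : derive_db.

Lemma gPhi_compl x : \int[mu]_(t in `[x, +oo[) gphi t = 1 - gPhi x.
Proof.
have iphi D : measurable D -> mu.-integrable D (EFin \o gphi).
  by move=> mD; apply: integrableS integrable_gphi.
rewrite -Rintegral_itv_obnd_cbnd; last exact: iphi.
have := @Rintegral_itvB R gphi -oo%O +oo%O x.
move=> /(_ _ _ _)<-//; last exact: iphi.
by rewrite set_itvE /Rintegral integral_normal_pdf.
Qed.

Lemma gPhiN x : gPhi (- x) = 1 - gPhi x.
Proof.
rewrite -gPhi_compl /Rintegral [LHS]/gPhi /Rintegral ge0_integration_by_substitutionNy.
- by congr fine; apply: eq_integral => t _; rewrite /= gphiN.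
- by apply: continuous_subspaceT; exact: continuous_gphi.
- by move=> y _; exact/ltW/gphi_gt0.
Qed.

Opaque gPhi.

Lemma gPhi0 : gPhi 0 = 2^-1.
Proof. by have := gPhiN 0; rewrite oppr0; lra. Qed.

Lemma xgphi_le x : 0 < x -> x * gphi x <= 2 * gphi 0 / x.
Proof.
move=> x0; have x20 : 0 < 1 + x ^+ 2 / 2 by have := sqr_ge0 x; lra.
apply: (@le_trans _ _ (x * (gphi 0 / (1 + x ^+ 2 / 2)))).
  by rewrite ler_pM2l// gphi_le.
rewrite mulrA ler_pdivrMr// mulrAC ler_pdivlMr// -subr_ge0.
rewrite [X in 0 <= X](_ : _ = 2 * gphi 0); first by rewrite mulr_ge0// ltW// gphi_gt0.
by field.
Qed.

Lemma xgphi_cvgy : x * gphi x @[x --> +oo] --> (0 : R).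
Proof.
apply/cvgrPdist_le => e e0; near=> x.
have x0 : 0 < x by near: x; exact: nbhs_pinfty_gt.
rewrite sub0r normrN ger0_norm; last by rewrite mulr_ge0// ltW// gphi_gt0.
apply: le_trans (xgphi_le x0) _; rewrite ler_pdivrMr// [leRHS]mulrC -ler_pdivrMr//.
Unshelve. all: by end_near. Qed.

Lemma gphi_cvgy : gphi x @[x --> +oo] --> (0 : R).
Proof.
apply/cvgrPdist_le => e e0; near=> x.
have x1 : 1 <= x by near: x; exact: nbhs_pinfty_ge.
have x0 : 0 < x by rewrite (lt_le_trans _ x1).
rewrite sub0r normrN ger0_norm; last by rewrite ltW// gphi_gt0.
apply: (@le_trans _ _ (x * gphi x)); first by rewrite ler_peMl// ltW// gphi_gt0.
apply: le_trans (xgphi_le x0) _; rewrite ler_pdivrMr// [leRHS]mulrC -ler_pdivrMr//.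
Unshelve. all: by end_near. Qed.

(* For N standard normal: E (x - N)^+, E (N - x)^+ and, below,
   sqr_up x = E ((N - x)^+)^2. *)
Definition mean_lo x := gphi x + x * gPhi x.
Definition mean_up x := gphi x - x * (1 - gPhi x).

Lemma mean_upN x : mean_up (- x) = mean_lo x.
Proof. by rewrite /mean_up /mean_lo gphiN gPhiN; ring. Qed.

(** Since phi' = - t phi, the integrand has the antiderivative - phi(t) - x Phi(t), with limit - x
    at infinity. *)
Lemma integral_mean_up x :
  (\int[mu]_(t in `[x, +oo[) ((t - x) * gphi t)%:E)%E = (mean_up x)%:E.
Proof.
pose G t := - gphi t + - (x * gPhi t).
have dG (t : R) : is_derive t (1 : R) G ((t - x) * gphi t) by rewrite /G; derive_all; ring.
rewrite (@ge0_continuous_FTC2y _ _ G x (- x)).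
- by rewrite -EFinB; congr EFin; rewrite /mean_up /G; ring.
- by move=> t xt; rewrite mulr_ge0 ?subr_ge0//; exact/ltW/gphi_gt0.
- apply: continuous_subspaceT => t; apply: cvgM.
    by apply: cvgB; [exact: cvg_id|exact: cvg_cst].
  exact: continuous_gphi.
- rewrite -[X in _ --> X](_ : - 0 - x * 1 = _); last by ring.
  apply: cvgB; first by apply: cvgN; exact: gphi_cvgy.
  by apply: cvgM; [exact: cvg_cst|exact: cvg_gPhiy].
- by move=> t _; case: (dG t).
- by apply: cvg_at_right_filter; exact: is_derive_continuous (dG x).
- by move=> t _; rewrite derive1E; case: (dG t).
Qed.

Definition sqr_up x := (1 + x ^+ 2) * (1 - gPhi x) - x * gphi x.

(** It is the integral of the nonnegative (t - x)^2 phi(t) over t >= x, computed from an explicit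
    antiderivative whose limit at infinity is 1 + x^2. *)
Lemma sqr_up_ge0 x : 0 <= sqr_up x.
Proof.
pose G t := (1 + x ^+ 2) * gPhi t + (x + x - t) * gphi t.
have dG (t : R) : is_derive t (1 : R) G ((t - x) ^+ 2 * gphi t) by rewrite /G; derive_all; ring.
have pos t : 0 <= (t - x) ^+ 2 * gphi t.
  by rewrite mulr_ge0 ?sqr_ge0//; exact/ltW/gphi_gt0.
rewrite -lee_fin.
suff <- : (\int[mu]_(t in `[x, +oo[) ((t - x) ^+ 2 * gphi t)%:E)%E = (sqr_up x)%:E.
  by apply: integral_ge0 => t _; rewrite lee_fin.
rewrite (@ge0_continuous_FTC2y _ _ G x (1 + x ^+ 2)).
- by rewrite -EFinB; congr EFin; rewrite /sqr_up /G; ring.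
- by [].
- apply: continuous_subspaceT => t; apply: (@is_derive_continuous _ (fun t => (t - x) ^+ 2 * gphi t)).
  by repeat derive_step.
- have -> : G = (fun t => (1 + x ^+ 2) * gPhi t + ((x + x) * gphi t - t * gphi t)).
    by apply/funext => t; rewrite /G; ring.
  rewrite -[X in _ --> X](_ : (1 + x ^+ 2) * 1 + ((x + x) * 0 - 0) = _); last by ring.
  apply: cvgD; first by apply: cvgM; [exact: cvg_cst|exact: cvg_gPhiy].
  apply: cvgB; last exact: xgphi_cvgy.
  by apply: cvgM; [exact: cvg_cst|exact: gphi_cvgy].
- by move=> t _; case: (dG t).
- by apply: cvg_at_right_filter; exact: is_derive_continuous (dG x).
- by move=> t _; rewrite derive1E; case: (dG t).
Qed.

Lemma mean_up_ge0 x : 0 <= mean_up x.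
Proof.
rewrite -lee_fin -integral_mean_up; apply: integral_ge0 => t /=.
by rewrite in_itv/= andbT => xt; rewrite lee_fin mulr_ge0 ?subr_ge0// ltW// gphi_gt0.
Qed.

Lemma mean_lo_ge0 x : 0 <= mean_lo x.
Proof. by rewrite -mean_upN mean_up_ge0. Qed.

(* 2 gJ bounds the derivative of the Stein solution. As gJ is even, its maximum
   is gJ 0 = gphi 0 once gU = gJ' is nonpositive on the half-line. *)
Definition gJ x := mean_lo x * mean_up x / gphi x.
Definition gU x :=
  (gPhi x * mean_up x - (1 - gPhi x) * mean_lo x + x * mean_lo x * mean_up x)
    / gphi x.

Lemma is_derive_mean_up x : is_derive x (1 : R) mean_up (gPhi x - 1).
Proof. by rewrite /mean_up; derive_all; ring. Qed.

Lemma is_derive_mean_lo x : is_derive x (1 : R) mean_lo (gPhi x).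
Proof. by rewrite /mean_lo; derive_all; ring. Qed.
Hint Resolve is_derive_mean_up is_derive_mean_lo : derive_db.

Lemma is_derive_gJ x : is_derive x (1 : R) gJ (gU x).
Proof. by rewrite /gJ; derive_all; [exact: gphi_neq0|rewrite /gU; field; exact: gphi_neq0]. Qed.

Definition gU1 x := (gphi x * (mean_lo x + mean_up x)
  - gPhi x * (1 - gPhi x) *+ 2 + mean_lo x * mean_up x
  + x * (gPhi x * mean_up x - (1 - gPhi x) * mean_lo x)
  + x * (gPhi x * mean_up x - (1 - gPhi x) * mean_lo x + x * mean_lo x * mean_up x))
    / gphi x.

Lemma is_derive_gU x : is_derive x (1 : R) gU (gU1 x).
Proof. by rewrite /gU; derive_all; [exact: gphi_neq0|rewrite /gU1; field; exact: gphi_neq0]. Qed.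

(** The third derivative of [gJ] closes up on [gJ] and [gJ'], with coefficients that are nonnegative
    for x >= 0: this sign drives the maximum principle in [gU_le0]. *)
Lemma is_derive_gU1 x : is_derive x (1 : R) gU1 ((x ^+ 2 + 6) * gU x + x * gJ x).
Proof.
rewrite /gU1; under eq_fun do rewrite mulr2n.
derive_all; first exact: gphi_neq0.
rewrite /gU /gJ /mean_lo /mean_up; field; exact: gphi_neq0.
Qed.

Lemma gJ_ge0 x : 0 <= gJ x.
Proof.
by rewrite divr_ge0 ?mulr_ge0 ?mean_up_ge0 ?mean_lo_ge0// ltW// gphi_gt0.
Qed.

(** Makes the positive part of [gU] vanish at infinity, so that the maximum principle can be run on
    a compact interval. *)
Lemma gU_le x : 0 <= x -> gU x <= (1 + gphi 0) / (1 + x ^+ 2).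
Proof.
move=> x0; have x21 : 0 < 1 + x ^+ 2 by have := sqr_ge0 x; lra.
(* The difference of the two sides is exactly x [sqr_up x]. *)
have up_le : (1 + x ^+ 2) * mean_up x <= gphi x.
  have := mulr_ge0 x0 (sqr_up_ge0 x); rewrite -subr_ge0.
  by congr (0 <= _); rewrite /sqr_up /mean_up; ring.
have phi_le : gphi x <= gphi 0.
  apply: le_trans (gphi_le x) _; rewrite ler_pdivrMr; last by have := sqr_ge0 x; lra.
  by rewrite ler_peMr ?(ltW (gphi_gt0 _))//; have := sqr_ge0 x; lra.
have xup_le : x * mean_up x <= gphi 0.
  apply: le_trans phi_le; apply: le_trans up_le.
  rewrite ler_wpM2r ?mean_up_ge0//; have := sqr_ge0 (x - 1); rewrite sqrrB1; nra.
rewrite /gU ler_pdivrMr ?gphi_gt0// [leRHS]mulrAC ler_pdivlMr//.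
(* Eliminates [mean_lo] by [mean_lo x] = [mean_up x] + x, and then uses x (1 - Phi(x)) = phi(x) -
   [mean_up x]. *)
have -> : gPhi x * mean_up x - (1 - gPhi x) * mean_lo x + x * mean_lo x * mean_up x =
   mean_up x * (gPhi x *+ 2 + x ^+ 2) - gphi x + x * mean_up x * mean_up x.
  by rewrite /mean_up /mean_lo; ring.
have P1 := gPhi_le1 x; have := mean_up_ge0 x; have := gphi_gt0 x.
set B := mean_up x in up_le xup_le *; set p := gphi x in up_le phi_le *.
set q := gphi 0 in phi_le xup_le *.
move=> p0 B0.
apply: (@le_trans _ _ ((B * (2 + x ^+ 2) - p + x * B * B) * (1 + x ^+ 2))).
  rewrite ler_pM2r// lerD2r lerD2r ler_wpM2l// lerD2r mulr2n; lra.
have h1 := ler_wpM2r (ltW p0) xup_le.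
have h2 := ler_wpM2l (mulr_ge0 x0 B0) up_le.
have h3 : 0 <= (2 + x ^+ 2) * (p - (1 + x ^+ 2) * B).
  by rewrite mulr_ge0 ?subr_ge0//; have := sqr_ge0 x; lra.
nra.
Qed.

Lemma gU0 : gU 0 = 0.
Proof. by rewrite /gU gPhi0 /mean_up /mean_lo; field; exact: gphi_neq0. Qed.

(* gU vanishes at 0 and at infinity, and gU'' = (x^2 + 6) gU + x gJ with gJ >= 0
   rules out a positive maximum in between. *)
Lemma gU_le0 x : 0 <= x -> gU x <= 0.
Proof.
rewrite le_eqVlt => /predU1P[<-|x0]; first by rewrite gU0.
rewrite leNgt; apply/negP => u0.
have phi0 := gphi_gt0 0.
(* Chosen so large that [gU_le] puts [gU y] below [gU x]: the maximum over [0, y] is then attained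
   in the interior. *)
pose y := x + 1 + (1 + gphi 0) / gU x.
have q0 : 0 < (1 + gphi 0) / gU x by rewrite divr_gt0//; lra.
have xy : x < y by rewrite /y; lra.
have y1 : 1 <= y by rewrite /y; lra.
have Uy : gU y < gU x.
  apply: le_lt_trans (gU_le _) _; first lra.
  rewrite ltr_pdivrMr; last by have := sqr_ge0 y; lra.
  rewrite mulrC -ltr_pdivrMr//; have : y <= y ^+ 2 by nra.
  by rewrite /y; lra.
have cU : {within `[0, y], continuous gU}.
  by apply: continuous_subspaceT => t; exact: is_derive_continuous (is_derive_gU t).
have [|c c0y maxc] := EVT_max _ cU; first lra.
have Uc0 : 0 < gU c.
  by apply: lt_le_trans u0 (maxc _ _); rewrite in_itv/=; apply/andP; split; lra.
have cy : 0 < c < y.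
  move: c0y; rewrite in_itv/= !le_eqVlt => /andP[/predU1P[c0|->] /predU1P[cy|->]]//.
  - lra.
  - by move: Uc0; rewrite -c0 gU0 ltxx.
  - have := maxc x; rewrite in_itv/= cy => /(_ _); lra.
have U1c : gU1 c = 0.
  have [] : is_derive c 1 gU 0; last first.
    by move=> _; have [_ ->] := is_derive_gU c.
  apply: (@derive1_at_max R gU 0 y c) => //; first lra.
  - by move=> t _; case: (is_derive_gU t).
  - by move=> t; rewrite in_itv/= => /andP[t0 ty]; apply: maxc; rewrite in_itv/= !ltW.
have [e /= e0 he] : \forall z \near c, 0 < gU z.
  have cUc : {for c, continuous gU} := is_derive_continuous (is_derive_gU c).
  exact: (cvgr_gt (gU c) cUc).
pose z := Num.min (c + e / 2) y.
have cz : c < z by rewrite lt_min; apply/andP; split; lra.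
have zy : z <= y by rewrite ge_min lexx orbT.
have ze : z < c + e by rewrite gt_min; apply/orP; left; lra.
(* As gU'(c) = 0, two applications of the mean value theorem give gU(z) - gU(c) = gU''(t2) (t1 - c)
   (z - c), which is positive because gU > 0 near c; this contradicts the maximality at c. *)
have [t1 + E1] := MVT_real cz is_derive_gU.
rewrite in_itv/= => /andP[ct1 t1z].
have [t2 + E2] := MVT_real ct1 is_derive_gU1.
rewrite in_itv/= => /andP[ct2 t2t1].
have : gU z <= gU c by apply: maxc; rewrite in_itv/=; apply/andP; split; lra.
have U2 : 0 < gU t2 by apply: he; rewrite /= ltr_distlC; apply/andP; split; lra.
have t20 : 0 < t2 by case/andP: cy => c0 _; lra.
have t26 : 0 < t2 ^+ 2 + 6 by have := sqr_ge0 t2; lra.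
have : 0 < (t2 ^+ 2 + 6) * gU t2 + t2 * gJ t2.
  exact: ltr_wpDr (mulr_ge0 (ltW t20) (gJ_ge0 t2)) (mulr_gt0 t26 U2).
rewrite U1c subr0 in E2; rewrite -subr_ge0 -opprB E1 E2 oppr_ge0 => h.
by rewrite leNgt !mulr_gt0//; lra.
Qed.

Lemma gJ_le x : gJ x <= gphi 0.
Proof.
have J0 : gJ 0 = gphi 0 by rewrite /gJ /mean_up /mean_lo; field; exact: gphi_neq0.
wlog x0 : x / 0 < x => [h|].
  have [x0|x0|<-] := ltgtP 0 x; [exact: h| |by rewrite J0].
  have -> : gJ x = gJ (- x).
    by rewrite /gJ gphiN mean_upN -[mean_lo (- x)]mean_upN opprK [mean_up x * _]mulrC.
  by apply: h; lra.
have [c + E] := MVT_real x0 is_derive_gJ.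
rewrite in_itv/= => /andP[c0 _].
have := gU_le0 (ltW c0); rewrite -J0; nra.
Qed.

Lemma integral_mean_lo x :
  (\int[mu]_(t in `]-oo, x]) ((x - t) * gphi t)%:E)%E = (mean_lo x)%:E.
Proof.
rewrite -[in LHS](opprK x) ge0_integration_by_substitutionNy; last 2 first.
- apply: continuous_subspaceT => t; apply: cvgM; last exact: continuous_gphi.
  by apply: cvgB; [exact: cvg_cst|exact: cvg_id].
- move=> t; rewrite in_itv/= => tx; rewrite mulr_ge0 ?subr_ge0 ?ltW//.
  exact: gphi_gt0.
rewrite -mean_upN -integral_mean_up; apply: eq_integral => t _ /=.
by rewrite gphiN !opprK addrC.
Qed.

End gauss.

(** * The solution of Stein's equation for a 1-Lipschitz function *)

Section stein.
Context {R : realType}.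
Local Notation mu := (@lebesgue_measure R).
Variable h : R -> R.
Hypothesis h_lip : forall x y, `|h x - h y| <= `|x - y|.

Lemma lip1_continuous : continuous h.
Proof.
move=> x; apply/cvgrPdist_le => e e0; near=> y.
apply: le_trans (h_lip _ _) _.
by near: y; apply: cvgr_dist_le => //; exact: cvg_id.
Unshelve. all: by end_near. Qed.

Let cont_dev (c : R) : continuous (fun t => (h t - c) * gphi t).
Proof.
move=> t; apply: cvgM; last exact: continuous_gphi.
by apply: cvgB; [exact: lip1_continuous|exact: cvg_cst].
Qed.

Let meas_dev (c : R) (D : set (measurableTypeR R)) :
  measurable_fun D (fun t => ((h t - c) * gphi t)%:E).
Proof.
apply: measurable_funTS; apply/measurable_EFinP.
exact: continuous_measurable_fun.
Qed.

Lemma integral_dev_up x :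
  (\int[mu]_(t in `[x, +oo[) `|((h t - h x) * gphi t)%:E| <= (mean_up x)%:E)%E.
Proof.
rewrite -integral_mean_up; apply: ge0_le_integral => //.
- by apply: measurableT_comp => //; exact: meas_dev.
- apply: measurable_funTS; apply/measurable_EFinP; apply: measurable_funM.
    by apply: measurable_funB.
  exact: continuous_measurable_fun continuous_gphi.
- move=> t; rewrite /= in_itv/= andbT => xt.
  rewrite lee_fin normrM (gtr0_norm (gphi_gt0 t)) ler_wpM2r ?(ltW (gphi_gt0 t))//.
  by apply: le_trans (h_lip _ _) _; rewrite ger0_norm// subr_ge0.
Qed.

Lemma integral_dev_lo x :
  (\int[mu]_(t in `]-oo, x]) `|((h t - h x) * gphi t)%:E| <= (mean_lo x)%:E)%E.
Proof.
rewrite -integral_mean_lo; apply: ge0_le_integral => //.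
- by apply: measurableT_comp => //; exact: meas_dev.
- apply: measurable_funTS; apply/measurable_EFinP; apply: measurable_funM.
    by apply: measurable_funB.
  exact: continuous_measurable_fun continuous_gphi.
- move=> t; rewrite /= in_itv/= => xt.
  rewrite lee_fin normrM (gtr0_norm (gphi_gt0 t)) ler_wpM2r ?(ltW (gphi_gt0 t))//.
  by apply: le_trans (h_lip _ _) _; rewrite distrC ger0_norm// subr_ge0.
Qed.

Let int_dev_up x : mu.-integrable `[x, +oo[ (EFin \o (fun t => (h t - h x) * gphi t)).
Proof.
apply/integrableP; split; first exact: meas_dev.
by apply: le_lt_trans (integral_dev_up x) _; rewrite ltry.
Qed.

Let int_dev_lo x : mu.-integrable `]-oo, x] (EFin \o (fun t => (h t - h x) * gphi t)).
Proof.
apply/integrableP; split; first exact: meas_dev.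
by apply: le_lt_trans (integral_dev_lo x) _; rewrite ltry.
Qed.

(** After centering at [h 0], the absolute integrals over the two half-lines are at most [mean_lo 0]
    and [mean_up 0]. *)
Lemma integrable_lip1_gphi : mu.-integrable setT (EFin \o (fun t => h t * gphi t)).
Proof.
have int0 : mu.-integrable setT (EFin \o (fun t => (h t - h 0) * gphi t)).
  apply/integrableP; split; first exact: meas_dev.
  have -> : [set: R] = `]-oo, 0] `|` `]0, +oo[.
    by rewrite (itv_setU_setT false (0 : R)).
  have mdev (D : set (measurableTypeR R)) :
      measurable_fun D (fun t => `|((h t - h 0) * gphi t)%:E|)%E.
    by apply: measurableT_comp => //; exact: meas_dev.
  rewrite ge0_integral_setU//.
  - apply: lte_add_pinfty; first by apply: le_lt_trans (integral_dev_lo 0) _; rewrite ltry.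
    apply: le_lt_trans (ltry (mean_up 0)).
    apply: le_trans (integral_dev_up 0).
    apply: ge0_subset_integral => //; try exact: mdev.
    by apply: subset_itvr; rewrite bnd_simp.
  - by apply/disj_setPS => t [] /=; rewrite !in_itv/= andbT leNgt => /negP.
have -> : EFin \o (fun t => h t * gphi t) =
    (EFin \o (fun t => (h t - h 0) * gphi t)) \+ (fun t => (h 0)%:E * (gphi t)%:E)%E.
  by apply/funext => t /=; rewrite -EFinM -EFinD; congr EFin; ring.
by apply: integrableD => //; apply: integrableZl => //; exact: integrable_gphi.
Qed.

Definition gmean : R := \int[mu]_t (h t * gphi t).

Let int_dev c D : measurable D ->
  mu.-integrable D (EFin \o (fun t => (h t - c) * gphi t)).
Proof.
move=> mD.
have -> : EFin \o (fun t => (h t - c) * gphi t) =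
    (EFin \o (fun t => h t * gphi t)) \+ (fun t => (- c)%:E * (gphi t)%:E)%E.
  by apply/funext => t /=; rewrite -EFinM -EFinD; congr EFin; ring.
apply: (integrableS measurableT) => //.
apply: integrableD => //; first exact: integrable_lip1_gphi.
by apply: integrableZl => //; exact: integrable_gphi.
Qed.

(** Centered at [h x] instead of the mean, so that the Lipschitz condition alone bounds these two
    integrals by [mean_lo] and [mean_up]. [stein_H] is centered at the mean E h(N), as the equation
    requires. *)
Definition dev_lo x : R := \int[mu]_(t in `]-oo, x]) ((h t - h x) * gphi t).
Definition dev_up x : R := \int[mu]_(t in `[x, +oo[) ((h t - h x) * gphi t).
Definition stein_H x : R := \int[mu]_(t in `]-oo, x]) ((h t - gmean) * gphi t).

Lemma dev_lo_le x : `|dev_lo x| <= mean_lo x.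
Proof.
apply: le_trans (le_normr_Rintegral _ (int_dev_lo x)) _ => //.
rewrite -lee_fin; apply: le_trans (integral_dev_lo x).
rewrite /Rintegral fineK//; apply: integrable_fin_num => //.
exact: integrable_norm.
Qed.

Lemma dev_up_le x : `|dev_up x| <= mean_up x.
Proof.
apply: le_trans (le_normr_Rintegral _ (int_dev_up x)) _ => //.
rewrite -lee_fin; apply: le_trans (integral_dev_up x).
rewrite /Rintegral fineK//; apply: integrable_fin_num => //.
exact: integrable_norm.
Qed.

Lemma gmeanE x : gmean = h x + dev_lo x + dev_up x.
Proof.
have id := int_dev (h x).
have -> : dev_up x = \int[mu]_(t in `]x, +oo[) ((h t - h x) * gphi t).
  by rewrite /dev_up -Rintegral_itv_obnd_cbnd//; exact: id.
have := @Rintegral_itvB R (fun t => (h t - h x) * gphi t) -oo%O +oo%O x.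
move=> /(_ _ _ _)<-//; last exact: id.
rewrite set_itvE -addrA [dev_lo x + _]addrC subrK.
have E : \int[mu]_t (h x * gphi t) = h x.
  rewrite RintegralZl//; last exact: integrable_gphi.
  by rewrite /Rintegral integral_normal_pdf mulr1.
rewrite -[X in X + _]E -RintegralD//; last 2 first.
- by apply: integrable_realZ => //; exact: integrable_gphi.
- exact: id.
by apply: eq_Rintegral => t _; ring.
Qed.

Lemma stein_HE x : stein_H x = dev_lo x + (h x - gmean) * gPhi x.
Proof.
rewrite /stein_H /dev_lo /gPhi.
rewrite -RintegralZl//; last by apply: integrableS integrable_gphi.
rewrite -RintegralD//.
- by apply: eq_Rintegral => t _; ring.
- by apply: integrable_realZ => //; apply: integrableS integrable_gphi.
Qed.

(** The Radon-Nikodym derivative of the normal law agrees almost everywhere with [gphi], because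
    both have the same integral over every measurable set. *)
Lemma ge0_integral_gauss (k : R -> \bar R) : measurable_fun setT k ->
  (forall x, 0 <= k x)%E ->
  (\int[normal_prob 0 1]_x k x = \int[mu]_x (k x * (gphi x)%:E))%E.
Proof.
move=> mk k0.
have dom := normal_prob_dominates (0 : R) 1.
rewrite -(Radon_Nikodym_SigmaFinite.change_of_variables dom)//.
apply: ae_eq_integral => //.
- apply: emeasurable_funM => //; apply: (measurable_int mu).
  exact: Radon_Nikodym_SigmaFinite.f_integrable.
- apply: emeasurable_funM => //; apply/measurable_EFinP.
  exact: measurable_normal_pdf.
apply: ae_eqe_mul2l => /=.
apply: integral_ae_eq => //.
- exact: Radon_Nikodym_SigmaFinite.f_integrable.
- by apply/measurable_EFinP; exact: measurable_normal_pdf.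
- by move=> E ET mE; rewrite -Radon_Nikodym_SigmaFinite.f_integral.
Qed.

(** Nonnegative integrands are transported to the law of [N] and then to Lebesgue measure; [h] is
    treated through its positive and negative parts. *)
Lemma integral_std_normal d (U : measurableType d) (Q : probability U R)
    (N : {RV Q >-> R}) :
  (forall A : set R, measurable A -> distribution Q N A = normal_prob 0 1 A) ->
  Q.-integrable setT (EFin \o (h \o N)) /\
  (\int[Q]_w (h (N w))%:E = gmean%:E)%E.
Proof.
move=> distN.
have mh : measurable_fun setT h by exact: continuous_measurable_fun lip1_continuous.
have mN : measurable_fun setT (N : U -> measurableTypeR R).
  by move=> _ B mB; rewrite setTI; exact: (measurable_funPTI N mB).
have gE (k : measurableTypeR R -> \bar R) : measurable_fun setT k -> (forall x, 0 <= k x)%E ->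
    (\int[Q]_w k (N w) = \int[mu]_x (k x * (gphi x)%:E))%E.
  move=> mk k0; rewrite -ge0_integral_gauss//.
  have := @ge0_integral_pushforward _ _ _ _ R (N : U -> measurableTypeR R) mN Q setT k measurableT mk.
  rewrite preimage_setT => <-; last by move=> y _; exact: k0.
  apply: eq_measure_integral => A mA _; exact: distN.
have ih : Q.-integrable setT (EFin \o (h \o N)).
  apply/integrableP; split; first exact/measurable_EFinP/measurableT_comp.
  rewrite /= (gE (fun x => `|(h x)%:E|%E)).
  - have /integrableP[_] := integrable_lip1_gphi; apply: le_lt_trans.
    rewrite le_eqVlt; apply/orP; left; apply/eqP; apply: eq_integral => x _.
    by rewrite /= -EFinM normrM (gtr0_norm (gphi_gt0 x)).
  - by apply: measurableT_comp => //; exact/measurable_EFinP.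
  - by [].
split => //.
rewrite /gmean /Rintegral fineK; last exact: integrable_fin_num integrable_lip1_gphi.
rewrite [LHS]integralE [RHS]integralE.
have mhE : measurable_fun setT (EFin \o h) by exact/measurable_EFinP.
congr (_ - _)%E.
- transitivity (\int[Q]_w ((EFin \o h)^\+ (N w)))%E.
    by apply: eq_integral => w _; rewrite !funeposE.
  rewrite gE//; last exact: measurable_funepos.
  apply: eq_integral => x _; rewrite !funeposE /= -!EFin_max -EFinM.
  by rewrite maxr_pMl ?(ltW (gphi_gt0 x))// mul0r.
- transitivity (\int[Q]_w ((EFin \o h)^\- (N w)))%E.
    by apply: eq_integral => w _; rewrite !funenegE.
  rewrite gE//; last exact: measurable_funeneg.
  apply: eq_integral => x _; rewrite !funenegE /= -!EFin_max -EFinM.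
  by rewrite maxr_pMl ?(ltW (gphi_gt0 x))// mul0r mulNr.
Qed.

Lemma is_derive_stein_H x : is_derive x (1 : R) stein_H ((h x - gmean) * gphi x).
Proof.
have xx1 : x < x + 1 by rewrite ltrDl.
have ih : mu.-integrable `]-oo, x + 1] (EFin \o (fun t => (h t - gmean) * gphi t)).
  exact: int_dev.
have [||d e] := continuous_FTC1 xx1 ih.
- by rewrite ltNyr.
- exact: cont_dev.
- by apply: DeriveDef; [exact: d|rewrite -derive1E; exact: e].
Qed.

(** The solution of g' - x g = h - E h(N) given by the integrating factor phi; [stein_dg] is g' as
    read off the equation. *)
Definition stein_g x := stein_H x / gphi x.
Definition stein_dg x := x * stein_g x + h x - gmean.

Lemma is_derive_stein_g x : is_derive x (1 : R) stein_g (stein_dg x).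
Proof.
have := is_derive_stein_H x; have := @is_derive_gphi R => ? ?.
rewrite /stein_g; derive_all; first exact: gphi_neq0.
by rewrite /stein_dg /stein_g; field; exact: gphi_neq0.
Qed.

(** Substituting E h(N) = h(x) + [dev_lo x] + [dev_up x] cancels h(x). What remains is a combination
    of the two deviations, each contributing at most [gJ x]. *)
Lemma stein_dg_bound x : `|stein_dg x| <= 2 * gphi 0.
Proof.
have -> : stein_dg x = - (mean_up x * dev_lo x + mean_lo x * dev_up x) / gphi x.
  rewrite /stein_dg /stein_g stein_HE (gmeanE x) /mean_up /mean_lo.
  by field; exact: gphi_neq0.
rewrite normrM normrN normfV (gtr0_norm (gphi_gt0 x)).
apply: (@le_trans _ _ (2 * gJ x)); last by rewrite ler_pM2l// gJ_le.
rewrite /gJ mulrA ler_pM2r ?invr_gt0 ?gphi_gt0//.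
apply: le_trans (ler_normD _ _) _; rewrite !normrM.
rewrite (ger0_norm (mean_up_ge0 x)) (ger0_norm (mean_lo_ge0 x)).
have := ler_wpM2l (mean_up_ge0 x) (dev_lo_le x).
have := ler_wpM2l (mean_lo_ge0 x) (dev_up_le x).
lra.
Qed.

(** The derivative of x g(x), the differentiable part of g'. As [h] is only Lipschitz, g'' need not
    exist: the Lipschitz constant 2 of g' is 1 from this bound plus 1 from [h]. *)
Definition stein_q x := stein_g x + x * stein_dg x.

(** The deviations appear here with the nonnegative weights [sqr_up x] and [sqr_up (- x)]; with the
    same weights, [mean_lo x] and [mean_up x] add up to exactly phi(x). *)
Lemma stein_q_bound x : `|stein_q x| <= 1.
Proof.
have -> : stein_q x = (dev_lo x * sqr_up x - dev_up x * sqr_up (- x)) / gphi x.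
  rewrite /stein_q /stein_dg /stein_g stein_HE (gmeanE x) /sqr_up gPhiN gphiN.
  by field; exact: gphi_neq0.
rewrite normrM normfV (gtr0_norm (gphi_gt0 x)) ler_pdivrMr ?gphi_gt0// mul1r.
apply: le_trans (ler_normB _ _) _; rewrite !normrM.
rewrite !(ger0_norm (sqr_up_ge0 _)).
have := ler_wpM2r (sqr_up_ge0 x) (dev_lo_le x).
have := ler_wpM2r (sqr_up_ge0 (- x)) (dev_up_le x).
have -> : gphi x = mean_lo x * sqr_up x + mean_up x * sqr_up (- x).
  by rewrite /sqr_up /mean_up /mean_lo gPhiN gphiN; ring.
lra.
Qed.

Lemma stein_dg_lip x y : `|stein_dg y - stein_dg x| <= 2 * `|y - x|.
Proof.
wlog xy : x y / x < y => [hwlog|].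
  have [xy|xy|->] := ltgtP x y; [exact: hwlog| |by rewrite !subrr normr0 mulr0].
  by rewrite distrC (distrC y); exact: hwlog.
have dxg (t : R) : is_derive t (1 : R) (fun t => t * stein_g t) (stein_q t).
  have := is_derive_stein_g t => ?.
  by derive_all; rewrite /stein_q mul1r.
have [c _ E] := MVT_real xy dxg.
have -> : stein_dg y - stein_dg x = stein_q c * (y - x) + (h y - h x).
  by rewrite -E /stein_dg; ring.
apply: le_trans (ler_normD _ _) _; rewrite normrM.
have := ler_wpM2r (normr_ge0 (y - x)) (stein_q_bound c).
have := h_lip y x; lra.
Qed.

(** Replaces the second-order Taylor formula: by the Lipschitz bound on g', the functions g(t) - t
    g'(x) -/+ (t - x)^2 have derivatives of known sign on either side of x. *)
Lemma stein_taylor x y :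
  `|stein_g y - stein_g x - stein_dg x * (y - x)| <= (y - x) ^+ 2.
Proof.
have dk (t : R) : is_derive t (1 : R)
    (fun t => stein_g t - t * stein_dg x - (t - x) ^+ 2) (stein_dg t - stein_dg x - 2 * (t - x)).
  by have := is_derive_stein_g t => ?; derive_all; rewrite expr1; ring.
have dl (t : R) : is_derive t (1 : R)
    (fun t => stein_g t - t * stein_dg x + (t - x) ^+ 2) (stein_dg t - stein_dg x + 2 * (t - x)).
  by have := is_derive_stein_g t => ?; derive_all; rewrite expr1; ring.
have [xy|yx|->] := ltgtP x y; last by rewrite !subrr mulr0 subr0 expr0n normr0.
- have [c + E] := MVT_real xy dk; rewrite in_itv/= => /andP[xc cy].
  have [c' + E'] := MVT_real xy dl; rewrite in_itv/= => /andP[xc' cy'].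
  rewrite subrr expr0n/= in E E'; rewrite ler_norml.
  have := stein_dg_lip x c; rewrite (gtr0_norm (_ : 0 < c - x)) ?subr_gt0// ler_norml => /andP[_ h1].
  have := stein_dg_lip x c'; rewrite (gtr0_norm (_ : 0 < c' - x)) ?subr_gt0// ler_norml => /andP[h2 _].
  by apply/andP; split; nra.
- have [c + E] := MVT_real yx dk; rewrite in_itv/= => /andP[yc cx].
  have [c' + E'] := MVT_real yx dl; rewrite in_itv/= => /andP[yc' cx'].
  rewrite subrr expr0n/= in E E'; rewrite ler_norml.
  have := stein_dg_lip x c; rewrite (ltr0_norm (_ : c - x < 0)) ?subr_lt0// ler_norml => /andP[h1 h1'].
  have := stein_dg_lip x c'; rewrite (ltr0_norm (_ : c' - x < 0)) ?subr_lt0// ler_norml => /andP[h2 h2'].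
  by apply/andP; split; nra.
Qed.

Lemma continuous_stein_dg : continuous stein_dg.
Proof.
move=> x; apply/cvgrPdist_le => e e0; near=> y.
apply: le_trans (stein_dg_lip _ _) _; rewrite mulrC -ler_pdivlMr//.
by near: y; apply: cvgr_dist_le => //; rewrite divr_gt0.
Unshelve. all: by end_near. Qed.

Lemma stein_g_lip x y : `|stein_g y - stein_g x| <= 2 * gphi 0 * `|y - x|.
Proof.
wlog xy : x y / x < y => [hwlog|].
  have [xy|xy|->] := ltgtP x y; [exact: hwlog| |by rewrite !subrr normr0 mulr0].
  by rewrite distrC (distrC y); exact: hwlog.
have [c _ ->] := MVT_real xy is_derive_stein_g.
by rewrite normrM ler_wpM2r// stein_dg_bound.
Qed.

End stein.

(** * Conditional expectations of functions of independent variables *)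

Section square_integrable.
Context d (T : measurableType d) (R : realType) (P : probability T R).
Implicit Types f g : T -> R.

Definition sqint f := measurable_fun setT f /\
  P.-integrable setT (EFin \o (fun x => f x ^+ 2)).

Lemma ae_sqint f g : measurable_fun setT g -> {ae P, forall x, f x = g x} ->
  sqint f -> sqint g.
Proof.
move=> mg fg [mf fi]; split => //; apply: (ae_eq_integrable_real _ _ _ _ fi) => //.
- exact: measurable_funX.
- exact: measurable_funX.
- by apply: filterS fg => x -> _.
Qed.

Lemma integrable_cst_real (c : R) : P.-integrable setT (EFin \o (fun=> c)).
Proof. exact: finite_measure_integrable_cst. Qed.

Lemma Rintegral_prob_cst (c : R) : \int[P]_x c = c.
Proof.
have -> // : \int[P]_x c = fine (c%:E * 1)%E; last by rewrite mule1.
rewrite /Rintegral integral_cst//; congr (fine (_ * _)%E); exact: probability_setT.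
Qed.

Lemma Rintegral_mulr f c : P.-integrable setT (EFin \o f) ->
  \int[P]_x (f x * c) = (\int[P]_x f x) * c.
Proof. by move=> fi; rewrite RintegralZr. Qed.

Lemma sqint_mul f g : sqint f -> sqint g ->
  P.-integrable setT (EFin \o (fun x => f x * g x)).
Proof.
move=> [mf fi] [mg gi].
apply: (@le_integrable_real _ _ _ _ _ _ _ (fun x => f x ^+ 2 + g x ^+ 2)) => //.
- exact: measurable_funM.
- move=> x _; rewrite normrM -(real_normK (num_real (f x))) -(real_normK (num_real (g x))).
  set a := `|f x|; set b := `|g x|.
  have a0 : 0 <= a := normr_ge0 _; have b0 : 0 <= b := normr_ge0 _.
  have := sqr_ge0 (a - b); rewrite sqrrB; have := mulr_ge0 a0 b0; lra.
- exact: integrable_realD.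
Qed.

Lemma sqint_cst c : sqint (fun=> c).
Proof. by split => //; exact: integrable_cst_real. Qed.

Lemma sqint_integrable f : sqint f -> P.-integrable setT (EFin \o f).
Proof.
move=> fi; have := sqint_mul fi (sqint_cst 1).
by apply: eq_integrable => // x _; rewrite /= mulr1.
Qed.

Lemma sqintD f g : sqint f -> sqint g -> sqint (fun x => f x + g x).
Proof.
move=> sf sg; have fg := sqint_mul sf sg; case: sf sg => [mf fi] [mg gi].
split; first exact: measurable_funD.
have := integrable_realD measurableT (integrable_realD measurableT fi (integrable_realZ measurableT 2 fg)) gi.
by apply: eq_integrable => // x _; rewrite /= sqrrD mulr_natl.
Qed.

Lemma sqintZ k f : sqint f -> sqint (fun x => k * f x).
Proof.
move=> [mf fi]; split; first exact: measurable_funM.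
have := integrable_realZ measurableT (k ^+ 2) fi.
by apply: eq_integrable => // x _; rewrite /= exprMn.
Qed.

Lemma sqintB f g : sqint f -> sqint g -> sqint (fun x => f x - g x).
Proof.
move=> sf sg; have := sqintD sf (sqintZ (-1) sg).
by under eq_fun do rewrite mulN1r.
Qed.

Lemma le_sqint f g : measurable_fun setT f -> (forall x, `|f x| <= `|g x|) ->
  sqint g -> sqint f.
Proof.
move=> mf fg [mg gi]; split => //; apply: le_integrable_real gi => //.
- exact: measurable_funX.
- move=> x _; rewrite normrX -(real_normK (num_real (g x))).
  by rewrite lerXn2r ?nnegrE.
Qed.

Lemma sqint_lip (k : R -> R) c f : measurable_fun setT k ->
  (forall x y, `|k x - k y| <= c * `|x - y|) -> sqint f -> sqint (k \o f).
Proof.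
move=> mk klip sf; have c0 : 0 <= c.
  by have := le_trans (normr_ge0 _) (klip 1 0); rewrite subr0 normr1 mulr1.
have h : sqint (fun x => k (f x) - k 0).
  apply: le_sqint (sqintZ c sf).
  - apply: measurable_funB => //; apply: measurableT_comp => //; by case: sf.
  - by move=> x; rewrite normrM (ger0_norm c0) -{2}[f x]subr0.
have := sqintD h (sqint_cst (k 0)).
by under eq_fun do rewrite subrK.
Qed.

(** Nonnegativity of the variance. *)
Lemma sqr_Rintegral_le f : sqint f ->
  (\int[P]_x f x) ^+ 2 <= \int[P]_x (f x ^+ 2).
Proof.
move=> sf; have fi := sqint_integrable sf; set m := \int[P]_x f x.
have : 0 <= \int[P]_x ((f x - m) ^+ 2) by apply: Rintegral_ge0 => x _; exact: sqr_ge0.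
have -> : \int[P]_x ((f x - m) ^+ 2) =
    \int[P]_x (f x ^+ 2 - (2 * m * f x - m ^+ 2)).
  by apply: eq_Rintegral => x _; ring.
have i1 := integrable_realZ measurableT (2 * m) fi.
rewrite RintegralB//; last 2 first.
- by case: sf.
- by apply: integrable_realB => //; exact: integrable_cst_real.
rewrite RintegralB//; last exact: integrable_cst_real.
by rewrite RintegralZl// Rintegral_prob_cst -/m => h; nra.
Qed.

(** With a = |f| and m its mean, this integrates the tangent inequality a^3 - 3 m^2 a + 2 m^3 = (a -
    m)^2 (a + 2 m) >= 0. *)
Lemma cube_Rintegral_le f : measurable_fun setT f ->
  P.-integrable setT (EFin \o (fun x => `|f x| ^+ 3)) ->
  `|\int[P]_x f x| ^+ 3 <= \int[P]_x (`|f x| ^+ 3).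
Proof.
move=> mf f3.
have fi : P.-integrable setT (EFin \o f).
  have h := integrable_realD measurableT (integrable_cst_real 1) f3.
  apply: (le_integrable_real measurableT mf _ h) => x _.
  have a0 := normr_ge0 (f x); have := mulr_ge0 a0 (sqr_ge0 (`|f x| - 1)).
  by rewrite !exprS expr0; nra.
have ai := integrable_norm fi.
set m := \int[P]_x `|f x|.
have m0 : 0 <= m by apply: Rintegral_ge0.
apply: (@le_trans _ _ (m ^+ 3)).
  by rewrite lerXn2r ?nnegrE//; exact: le_normr_Rintegral.
have : 0 <= \int[P]_x ((`|f x| - m) ^+ 2 * (`|f x| + 2 * m)).
  by apply: Rintegral_ge0 => x _; rewrite mulr_ge0 ?sqr_ge0// addr_ge0// mulr_ge0.
have -> : \int[P]_x ((`|f x| - m) ^+ 2 * (`|f x| + 2 * m)) =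
    \int[P]_x (`|f x| ^+ 3 - (3 * m ^+ 2 * `|f x| - 2 * m ^+ 3)).
  by apply: eq_Rintegral => x _; ring.
have i1 := integrable_realZ measurableT (3 * m ^+ 2) ai.
rewrite RintegralB//; last by apply: integrable_realB => //; exact: integrable_cst_real.
rewrite RintegralB//; last exact: integrable_cst_real.
rewrite RintegralZl// Rintegral_prob_cst -/m.
have -> : 3 * m ^+ 2 * m - 2 * m ^+ 3 = m ^+ 3 by ring.
by rewrite subr_ge0.
Qed.

(** Splits [f] into a bounded part and a part that is small in L^2. The truncated squares vanish
    pointwise once the level exceeds |f(x)| and are dominated by f^2. *)
Lemma sqint_tail f e : sqint f -> 0 < e ->
  exists2 c, 0 <= c & \int[P]_x (Num.max (`|f x| - c) 0 ^+ 2) <= e.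
Proof.
move=> [mf fi] e0.
pose t n x := Num.max (`|f x| - n%:R) 0 ^+ 2.
have mt n : measurable_fun setT (t n).
  apply: measurable_funX; apply: measurable_maxr => //.
  by apply: measurable_funB => //; exact: measurableT_comp.
have t_le n x : 0 <= t n x <= f x ^+ 2.
  rewrite sqr_ge0/= -(real_normK (num_real (f x))) lerXn2r ?nnegrE//.
  by rewrite ge_max normr_ge0 andbT lerBlDr lerDl.
have it n : P.-integrable setT (EFin \o t n).
  apply: (le_integrable_real measurableT _ _ fi) => // x _.
  by case/andP: (t_le n x) => h1 h2; rewrite ger0_norm.
have cvgt : (fun n => \int[P]_x (t n x)%:E)%E @ \oo --> (\int[P]_x (0 : \bar R))%E.
  apply: (@dominated_cvg _ _ _ P setT measurableT (fun n x => (t n x)%:E) (fun=> 0%E)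
     (fun x => (f x ^+ 2)%:E)) => //.
  - by move=> n; apply/measurable_EFinP.
  - move=> x _; apply: cvg_near_cst; near=> n.
    congr EFin; rewrite /t (_ : Num.max _ _ = 0) ?expr0n//.
    apply/max_idPr; rewrite subr_le0.
    by near: n; exact: nbhs_infty_ger.
  - move=> n x _; rewrite gee0_abs lee_fin; by case/andP: (t_le n x).
rewrite integral0 in cvgt.
have {}cvgt : (fun n => \int[P]_x t n x) @ \oo --> (0 : R).
  apply: (@fine_cvg _ _ _ _ (fun n => (\int[P]_x (t n x))%:E)).
  by under eq_fun do rewrite -EFin_Rintegral//.
move/cvgrPdist_le : cvgt => /(_ _ e0)[N _ /(_ N (leqnn N))].
rewrite sub0r normrN => h; exists N%:R => //.
exact: le_trans (ler_norm _) h.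
Unshelve. all: by end_near. Qed.

End square_integrable.

(** * Uniqueness of conditional expectations *)

Section cond_exp.
Context d (T : measurableType d) (R : realType) (P : probability T R).
Variable G : set (set T).
Hypothesis Gm : <<s G >> `<=` measurable.

Lemma cond_exp_unique (Y Z1 Z2 : T -> R) :
  is_cond_exp P G Y Z1 -> is_cond_exp P G Y Z2 ->
  {ae P, forall w, Z1 w = Z2 w}.
Proof.
move=> [mZ1 iZ1 hZ1] [mZ2 iZ2 hZ2].
have mid : measurable_fun setT (idfun : T -> g_sigma_algebraType G).
  by move=> _ A mA; rewrite setTI; exact: Gm.
(* The restriction of [P] to the generated sigma-algebra, as the image of [P] under the identity;
   both versions are measurable there and have equal integrals over all its sets. *)
pose PG := @measure_function_pushforward__canonical__measure_function_Measure
  _ _ T (g_sigma_algebraType G) R P _ mid.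
have ae_PG : ae_eq PG setT (EFin \o Z1) (EFin \o Z2).
  apply: integral_ae_eq => //.
  - by apply: (integrable_pushforward mid) => //; exact/measurable_EFinP.
  - exact/measurable_EFinP.
  - move=> A _ mA.
    have mAT : @measurable d T A by exact: Gm.
    rewrite (@integral_pushforward _ _ _ _ _ _ mid P A (EFin \o Z1))//; first last.
    + exact: (integrableS measurableT).
    + exact/measurable_EFinP.
    rewrite (@integral_pushforward _ _ _ _ _ _ mid P A (EFin \o Z2))//; first last.
    + exact: (integrableS measurableT).
    + exact/measurable_EFinP.
    by rewrite preimage_id hZ1// hZ2.
case: ae_PG => A [mA A0 subA]; exists A; split => //; first exact: Gm.
by apply: subset_trans subA => w /= h1 h2; apply: h1; have [] := h2 I.
Qed.

End cond_exp.

(** * The sequence space and exchanges of coordinates *)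

Section seq_space.
Context (d' : measure_display) (S : measurableType d').
Local Notation SS := (seq_space S).

(** Serves both purposes: with [K] all indices but [i] it resamples coordinate [i]; integrating out
    [y] conditions on the coordinates in [K]. *)
Definition mixs (K : pred nat) (x y : SS) : SS :=
  fun k => if K k then x k else y k.

Lemma measurable_coord k : measurable_fun setT (fun x : SS => x k).
Proof.
move=> _ B mB; apply: sub_sigma_algebra; exists k => //.
by exists B.
Qed.

Lemma measurable_seqP d0 (U : measurableType d0) (h : U -> SS) :
  (forall k, measurable_fun setT (fun u => h u k)) -> measurable_fun setT h.
Proof.
move=> mh; apply: (@measurability _ _ U SS setT h (gen_sigma (fun k (x : nat -> S) => x k) setT)) => //.
move=> _ [_ [k _ [B mB <-]] <-]; rewrite !setTI.
by have := mh k measurableT _ mB; rewrite setTI.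
Qed.

Lemma measurable_mixs (K : pred nat) :
  measurable_fun setT (fun p : SS * SS => mixs K p.1 p.2).
Proof.
apply: measurable_seqP => k; rewrite /mixs; case: (K k).
- exact: measurableT_comp (measurable_coord k) measurable_fst.
- exact: measurableT_comp (measurable_coord k) measurable_snd.
Qed.

Definition cylinder : set (set SS) :=
  [set [set x | forall k, A k (x k)] | A in
    [set A : nat -> set S | (forall k, measurable (A k)) /\
      exists n, forall k, (n <= k)%N -> A k = setT]].

Lemma measurable_cylinder C : cylinder C -> measurable C.
Proof.
move=> [A [mA _] <-].
have -> : [set x | forall k, A k (x k)] = \bigcap_k ((fun x : SS => x k) @^-1` A k).
  by apply/seteqP; split => [x Ax k _|x Ax k]; [exact: Ax|exact: Ax].
apply: bigcapT_measurable => k; rewrite -[X in measurable X]setTI.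
exact: measurable_coord.
Qed.

Lemma cylinderT : cylinder setT.
Proof.
exists (fun=> setT); first by split => //; exists 0%N.
by apply/seteqP; split.
Qed.

Lemma cylinder1 k (B : set S) : measurable B -> cylinder [set x | B (x k)].
Proof.
move=> mB; exists (fun j => if j == k then B else setT).
  split => [j|]; first by case: ifP.
  by exists k.+1 => j kj; rewrite ifF//; apply/negbTE; rewrite gtn_eqF.
apply/seteqP; split => [x /(_ k)|x Bx j]; first by rewrite eqxx.
by case: eqP => // ->.
Qed.

(** A generating system stable under intersection, on which laws of pairs of sequences are compared.
    Cylinders restrict finitely many coordinates, the only events on which independence speaks
    directly. *)
Definition cylinder2 : set (set (SS * SS)) :=
  [set C.1 `*` C.2 | C in cylinder `*` cylinder].

Lemma cylinder2_setI : setI_closed cylinder2.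
Proof.
have cylI A B : cylinder A -> cylinder B -> cylinder (A `&` B).
  move=> [a [ma [n an]] <-] [b [mb [m bm]] <-].
  exists (fun k => a k `&` b k); first split => [k|].
  - exact: measurableI.
  - exists (maxn n m) => k; rewrite geq_max => /andP[nk mk].
    by rewrite an// bm// setTI.
  - by apply/seteqP; split => [x h|x [h1 h2] k]; split => // k; case: (h k).
move=> _ _ [[A B] /= [cA cB] <-] [[C D] /= [cC cD] <-].
by exists (A `&` C, B `&` D); [split; exact: cylI|rewrite setXI].
Qed.

Lemma measurable_cylinder2 :
  @measurable _ (SS * SS)%type = <<s cylinder2 >>.
Proof.
have sub (p : SS * SS -> SS) : (forall k (B : set S), measurable B ->
      cylinder2 (p @^-1` [set x | B (x k)])) ->
    preimage_set_system setT p measurable `<=` <<s cylinder2 >>.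
  move=> hp.
  rewrite -(@g_sigma_preimageE _ (nat -> S) setT p (gen_sigma (fun k (x : nat -> S) => x k) setT)).
  apply: smallest_sub; first exact: smallest_sigma_algebra.
  move=> _ [_ [k _ [B mB <-]] <-]; rewrite !setTI; apply: sub_sigma_algebra.
  exact: hp.
rewrite eqEsubset; split.
  apply: smallest_sub; first exact: smallest_sigma_algebra.
  rewrite subUset; split; apply: sub => k B mB.
  - exists ([set x | B (x k)], setT) => /=.
      by split; [exact: cylinder1|exact: cylinderT].
    by apply/seteqP; split => -[x y] //= [].
  - exists (setT, [set x | B (x k)]) => /=.
      by split; [exact: cylinderT|exact: cylinder1].
    by apply/seteqP; split => -[x y] //= [].
apply: smallest_sub; first exact: sigma_algebra_measurable.
by move=> _ [[A B] [cA cB] <-]; apply: measurableX; exact: measurable_cylinder.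
Qed.

Definition sw (L : pred nat) (p : SS * SS) : SS * SS :=
  (mixs (predC L) p.1 p.2, mixs (predC L) p.2 p.1).

Lemma measurable_sw L : measurable_fun setT (sw L).
Proof.
apply: measurable_fun_pair; first exact: measurable_mixs.
apply: (measurableT_comp (measurable_mixs (predC L)) (g := fun p : SS * SS => (p.2, p.1))).
exact: measurable_swap.
Qed.

Lemma mixs_sw K L p : mixs K (sw L p).1 (sw L p).2 =
  mixs (fun k => K k (+) L k) p.1 p.2.
Proof. by apply/funext => k; rewrite /sw /mixs /=; case: (K k) (L k) => [] []. Qed.

End seq_space.

(** * Fubini's theorem for real-valued integrals *)

Section fubini_real.
Context (d1 d2 : measure_display) (R : realType) (T1 : measurableType d1)
  (T2 : measurableType d2) (P1 : probability T1 R) (P2 : probability T2 R).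
Variable g : T1 * T2 -> R.
Hypothesis ig : (P1 \x P2)%E.-integrable setT (EFin \o g).

(** [fine] sends an infinite inner integral to 0, so agreement with the extended inner integral
    holds only almost everywhere. *)
Let inner x : R := \int[P2]_y g (x, y).

Lemma ae_inner_integrable :
  {ae P1, forall x, P2.-integrable setT (EFin \o (fun y => g (x, y)))}.
Proof. exact: (ae_integrable1 ig). Qed.

Let ae_innerE : ae_eq P1 setT (fubini_F P2 (EFin \o g)) (EFin \o inner).
Proof.
have := integrable_ae measurableT (integrable_fubini_F ig).
apply: filterS => x /(_ I) xfin _.
by rewrite /= /inner /Rintegral fineK.
Qed.

Lemma integrable_inner : P1.-integrable setT (EFin \o inner).
Proof.
apply: (le_integrable measurableT _ _ (integrable_fubini_F ig)).
- apply/measurable_EFinP; apply: measurableT_comp => //.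
  exact: (measurable_fubini_F ig).
- move=> x _; rewrite /= /inner /Rintegral /fubini_F /=.
  by case: (\int[P2]_y (g (x, y))%:E)%E => [r| |] //=; rewrite ?leey.
Qed.

Lemma Rintegral_inner : \int[P1]_x inner x = \int[(P1 \x P2)%E]_z g z.
Proof.
rewrite /Rintegral -(integral12_prod_meas1 ig); congr fine.
apply: ae_eq_integral => //.
- by have /integrableP[] := integrable_inner.
- exact: (measurable_fubini_F ig).
- by apply: ae_eq_sym; exact: ae_innerE.
Qed.

(** Integrates the first variable first: the original sequence varies while the resampled copy stays
    frozen. *)
Lemma Rintegral_eq0_snd : {ae P2, forall y, \int[P1]_x g (x, y) = 0} ->
  \int[(P1 \x P2)%E]_z g z = 0.
Proof.
move=> g0; rewrite /Rintegral -(integral21_prod_meas1 ig) (_ : 0 = fine 0%E)//.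
congr fine; rewrite -[RHS](integral0 P2 setT); apply: ae_eq_integral => //.
- exact: (measurable_fubini_G ig).
- have := ae_integrable2 ig; move: g0; apply: filterS2 => y g0 iy _.
  by rewrite /fubini_G /= (EFin_Rintegral measurableT iy) g0.
Qed.

End fubini_real.

(** * Invariance of the pair of copies under exchanges of coordinates *)

Section indep.
Context (d d' : measure_display) (R : realType) (T : measurableType d)
  (S : measurableType d') (P : probability T R) (X : nat -> {RV P >-> S}).
Hypothesis indepX : mutually_independent P X.
Local Notation SS := (seq_space S).

Definition traj (w : T) : SS := fun k => X k w.
Definition traj2 (z : T * T) : SS * SS := (traj z.1, traj z.2).

Lemma measurable_traj : measurable_fun setT traj.
Proof. by apply: measurable_seqP => k. Qed.

Lemma measurable_traj2 : measurable_fun setT traj2.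
Proof.
apply: measurable_fun_pair.
- exact: measurableT_comp measurable_traj measurable_fst.
- exact: measurableT_comp measurable_traj measurable_snd.
Qed.

Local Open Scope ereal_scope.

Lemma traj_cylinder (A : nat -> set S) n : (forall k, measurable (A k)) ->
  (forall k, (n <= k)%N -> A k = setT) ->
  P (traj @^-1` [set x | forall k, A k (x k)]) =
  \prod_(k <- [fset k in iota 0 n]%fset) P (X k @^-1` A k).
Proof.
move=> mA An; rewrite -indepX//; congr (P _); apply/seteqP; split => w /=.
  by move=> h k _; exact: h.
move=> h k; have [kn|nk] := ltnP k n; last by rewrite An.
by apply: h; rewrite /= !inE mem_iota.
Qed.

(** On a product of two cylinders the probability is a product over k of P(X_k in a_k) P(X_k in
    b_k); the exchange swaps a_k and b_k for k in [L], which leaves each factor unchanged.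
    Uniqueness of measures extends this to all events. *)
Lemma swap_law L A : measurable A ->
  (P \x P) (traj2 @^-1` A) = (P \x P) ((sw L \o traj2) @^-1` A).
Proof.
have m2t := measurable_traj2.
have msw : measurable_fun setT (sw L \o traj2).
  exact: measurableT_comp (measurable_sw L) measurable_traj2.
pose pushm := @measure_function_pushforward__canonical__measure_function_Measure
  _ _ (T * T)%type (SS * SS)%type R (P \x P).
have uniq := @measure_unique _ R (SS * SS)%type (@cylinder2 _ S) (fun=> setT)
  (@measurable_cylinder2 _ S) (@cylinder2_setI _ S).
have {}uniq := uniq _ _ (pushm _ m2t) (pushm _ msw).
move=> mA; apply: uniq => //.
- move=> _; exists (setT, setT); first by split; exact: cylinderT.
  by rewrite /= setXTT.
- by rewrite bigcup_const.
- move=> _ [[C1 C2] /= [[a [ma [n an]] <-] [b [mb [m bm]] <-]] <-].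
  pose N := maxn n m.
  have aN k : (N <= k)%N -> a k = setT by rewrite geq_max => /andP[nk _]; exact: an.
  have bN k : (N <= k)%N -> b k = setT by rewrite geq_max => /andP[_ nk]; exact: bm.
  pose a' k := if L k then b k else a k.
  pose b' k := if L k then a k else b k.
  have PE (u v : nat -> set S) : (forall k, measurable (u k)) -> (forall k, measurable (v k)) ->
     (forall k, (N <= k)%N -> u k = setT) -> (forall k, (N <= k)%N -> v k = setT) ->
     (P \x P) (traj2 @^-1` ([set x | forall k, u k (x k)] `*` [set x | forall k, v k (x k)])) =
     \prod_(k <- [fset k in iota 0 N]%fset) (P (X k @^-1` u k) * P (X k @^-1` v k)).
    move=> mu mv uN vN.
    have -> : traj2 @^-1` ([set x | forall k, u k (x k)] `*` [set x | forall k, v k (x k)]) =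
      (traj @^-1` [set x | forall k, u k (x k)]) `*` (traj @^-1` [set x | forall k, v k (x k)]) by [].
    rewrite product_measure1E.
    + by rewrite big_split; congr (_ * _); exact: traj_cylinder.
    + rewrite -[X in measurable X]setTI; apply: measurable_traj => //.
      by apply: measurable_cylinder; exists u => //; split => //; exists N.
    + rewrite -[X in measurable X]setTI; apply: measurable_traj => //.
      by apply: measurable_cylinder; exists v => //; split => //; exists N.
  rewrite /pushforward /= PE//.
  have -> : (sw L \o traj2) @^-1` ([set x | forall k, a k (x k)] `*` [set x | forall k, b k (x k)]) =
     traj2 @^-1` ([set x | forall k, a' k (x k)] `*` [set x | forall k, b' k (x k)]).
    apply/seteqP; split => -[w w'] /= [h1 h2]; split => k; move: (h1 k) (h2 k);
      by rewrite /a' /b' /= /mixs /=; case: (L k).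
  rewrite PE//.
  + by apply: eq_bigr => k _; rewrite /a' /b'; case: (L k) => //; rewrite muleC.
  + by move=> k; rewrite /a'; case: ifP.
  + by move=> k; rewrite /b'; case: ifP.
  + by move=> k kN; rewrite /a' aN// bN//; case: ifP.
  + by move=> k kN; rewrite /b' aN// bN//; case: ifP.
- by move=> _; rewrite /= /pushforward preimage_setT probability_setT ltry.
Qed.

Lemma ge0_swap_integral L (Phi : SS * SS -> \bar R) :
  measurable_fun setT Phi -> (forall p, 0 <= Phi p) ->
  \int[P \x P]_z Phi (traj2 z) = \int[P \x P]_z Phi (sw L (traj2 z)).
Proof.
move=> mPhi Phi0.
have m2t := measurable_traj2.
have msw : measurable_fun setT (sw L \o traj2).
  exact: measurableT_comp (measurable_sw L) measurable_traj2.
have i1 := ge0_integral_pushforward m2t (P \x P) measurableT mPhi (fun p _ => Phi0 p).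
have i2 := ge0_integral_pushforward msw (P \x P) measurableT mPhi (fun p _ => Phi0 p).
rewrite !preimage_setT in i1 i2; rewrite -[LHS]i1 -[RHS]i2.
by apply: eq_measure_integral => A mA _; exact: swap_law.
Qed.

Lemma swap_integral L (Phi : SS * SS -> \bar R) : measurable_fun setT Phi ->
  \int[P \x P]_z Phi (traj2 z) = \int[P \x P]_z Phi (sw L (traj2 z)).
Proof.
move=> mPhi; rewrite [LHS]integralE [RHS]integralE; congr (_ - _).
- transitivity (\int[P \x P]_z Phi^\+ (traj2 z)).
    by apply: eq_integral => z _; rewrite !funeposE.
  rewrite (@ge0_swap_integral L Phi^\+ (measurable_funepos mPhi))//.
  by apply: eq_integral => z _; rewrite !funeposE.
- transitivity (\int[P \x P]_z Phi^\- (traj2 z)).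
    by apply: eq_integral => z _; rewrite !funenegE.
  rewrite (@ge0_swap_integral L Phi^\- (measurable_funeneg mPhi))//.
  by apply: eq_integral => z _; rewrite !funenegE.
Qed.

Definition mx (K : pred nat) (z : T * T) : SS := mixs K (traj z.1) (traj z.2).

Lemma measurable_mx K : measurable_fun setT (mx K).
Proof. exact: measurableT_comp (measurable_mixs K) measurable_traj2. Qed.

Lemma ge0_integral_fst (phi : T -> \bar R) : measurable_fun setT phi ->
  (forall x, 0 <= phi x) -> \int[P \x P]_z phi z.1 = \int[P]_w phi w.
Proof.
move=> mphi phi0.
rewrite (@fubini_tonelli1 _ _ _ _ _ P P (fun z => phi z.1))//.
- apply: eq_integral => w _.
  rewrite /fubini_F /= integral_cst// -[RHS]mule1; congr (_ * _).
  exact: probability_setT.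
- exact: measurableT_comp mphi measurable_fst.
Qed.

(** A mixture of the two copies has the law of one of them: it is the first component after
    exchanging the coordinates outside [K]. *)
Lemma ge0_integral_mx K (phi : SS -> \bar R) : measurable_fun setT phi ->
  (forall x, 0 <= phi x) ->
  \int[P \x P]_z phi (mx K z) = \int[P]_w phi (traj w).
Proof.
move=> mphi phi0; rewrite -(ge0_integral_fst (phi := phi \o traj)); last 2 first.
- exact: measurableT_comp mphi measurable_traj.
- by move=> w; exact: phi0.
have := @ge0_swap_integral (predC K) (phi \o fst)
  (measurableT_comp mphi measurable_fst) (fun p => phi0 _).
move=> /= ->; apply: eq_integral => z _; congr (phi _).
by apply/funext => k; rewrite /mx /mixs /= negbK.
Qed.

Lemma integrable_mx K (phi : SS -> R) : measurable_fun setT phi ->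
  P.-integrable setT (EFin \o (phi \o traj)) ->
  (P \x P).-integrable setT (EFin \o (phi \o mx K)).
Proof.
move=> mphi /integrableP[_ ifoo]; apply/integrableP; split.
  by apply/measurable_EFinP; exact: measurableT_comp mphi (measurable_mx K).
rewrite (@ge0_integral_mx K (fun x => `|(phi x)%:E|))//.
by apply: measurableT_comp => //; exact/measurable_EFinP.
Qed.

Lemma integrable_fst (phi : T -> R) : P.-integrable setT (EFin \o phi) ->
  (P \x P).-integrable setT (EFin \o (fun z : T * T => phi z.1)).
Proof.
move=> /integrableP[/measurable_EFinP mphi ifoo]; apply/integrableP; split.
  by apply/measurable_EFinP; exact: measurableT_comp mphi measurable_fst.
rewrite (@ge0_integral_fst (fun x => `|(phi x)%:E|))//.
by apply: measurableT_comp => //; exact/measurable_EFinP.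
Qed.

Local Close Scope ereal_scope.

Lemma swap_Rintegral L (Phi : SS * SS -> R) : measurable_fun setT Phi ->
  \int[(P \x P)%E]_z Phi (traj2 z) = \int[(P \x P)%E]_z Phi (sw L (traj2 z)).
Proof.
move=> mPhi; congr fine.
by apply: (@swap_integral L (EFin \o Phi)); exact/measurable_EFinP.
Qed.

(* Exchanging the coordinates in L of the two copies turns mx K into the mixture
   along the symmetric difference of K and L, and does not affect psi. *)
Lemma pair_swap K L (phi psi : SS -> R) :
  measurable_fun setT phi -> measurable_fun setT psi ->
  (forall x y, (forall k, ~~ L k -> x k = y k) -> psi x = psi y) ->
  \int[(P \x P)%E]_z (phi (mx K z) * psi (traj z.1)) =
  \int[(P \x P)%E]_z (phi (mx (fun k => K k (+) L k) z) * psi (traj z.1)).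
Proof.
move=> mphi mpsi psiL.
rewrite (@swap_Rintegral L (fun p => phi (mixs K p.1 p.2) * psi p.1)); last first.
  apply: measurable_funM.
    exact: measurableT_comp mphi (measurable_mixs K).
  exact: measurableT_comp mpsi measurable_fst.
apply: eq_Rintegral => z _; rewrite mixs_sw; congr (_ * _).
by apply: psiL => k Lk; rewrite /= /mixs /= Lk.
Qed.

(** * Conditional expectations given a set of coordinates *)

Lemma gen_sigma_measurable K : <<s gen_sigma (fun k => X k : T -> S) K >> `<=` measurable.
Proof.
apply: smallest_sub; first exact: sigma_algebra_measurable.
by move=> _ [k _ [B mB <-]]; exact: measurable_funP.
Qed.

(** The sets of this form are a sigma-algebra containing the generators. Insensitivity of [B] to the
    coordinates outside [K] is what allows those to be exchanged. *)
Lemma gen_sigma_preimage (K : pred nat) A :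
  <<s gen_sigma (fun k => X k : T -> S) [set k | K k] >> A ->
  exists B : set SS, [/\ measurable B,
    (forall x y : SS, (forall k, K k -> x k = y k) -> B x -> B y) &
    A = traj @^-1` B].
Proof.
pose C := [set A | exists B : set SS, [/\ measurable B,
    (forall x y : SS, (forall k, K k -> x k = y k) -> B x -> B y) &
    A = traj @^-1` B]].
suff : <<s gen_sigma (fun k => X k : T -> S) [set k | K k] >> `<=` C by apply.
apply: smallest_sub; first split.
- by exists set0; split => //; rewrite preimage_set0.
- move=> _ [B [mB KB ->]]; exists (~` B); split.
  + exact: measurableC.
  + by move=> x y xy nBx By; apply: nBx; apply: KB By => k Kk; rewrite xy.
  + by rewrite setTD preimage_setC.
- move=> F CF; have [B hB] := choice CF.
  exists (\bigcup_k B k); split.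
  + by apply: bigcupT_measurable => k; have [] := hB k.
  + by move=> x y xy [k _ Bx]; exists k => //; have [_ h _] := hB k; exact: h Bx.
  + by rewrite preimage_bigcup; apply: eq_bigcupr => k _; have [_ _] := hB k.
- move=> _ [k Kk [B mB <-]]; exists [set x : SS | B (x k)]; split.
  + by rewrite -[X in measurable X]setTI; exact: measurable_coord.
  + by move=> x y xy /=; rewrite xy.
  + by rewrite setTI.
Qed.

(** A canonical version of E[phi(X) | X_k, k in K], defined at every point. *)
Definition EK K (phi : SS -> R) (w : T) : R :=
  \int[P]_w' phi (mixs K (traj w) (traj w')).

Lemma integrable_EK K phi : measurable_fun setT phi ->
  P.-integrable setT (EFin \o (phi \o traj)) ->
  P.-integrable setT (EFin \o EK K phi).
Proof. by move=> mphi iphi; exact: integrable_inner (integrable_mx K mphi iphi). Qed.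

Lemma measurable_param_Rintegral d1 (T1 : measurableType d1) (g : T1 * T -> R) :
  measurable_fun setT g -> measurable_fun setT (fun x => \int[P]_y g (x, y)).
Proof.
move=> mg; have mgE : measurable_fun setT (EFin \o g) by exact/measurable_EFinP.
rewrite /Rintegral.
apply: (@measurableT_comp _ _ _ _ _ _ (@fine R)); first exact: fine_measurable.
under eq_fun do rewrite integralE.
apply: emeasurable_funB.
- have := @measurable_fun_fubini_tonelli_F _ _ T1 T R P (EFin \o g)^\+%E (measurable_funepos mgE) (fun=> funepos_ge0 _ _).
  by apply: eq_measurable_fun => x _; apply: eq_integral => y _; rewrite !funeposE.
- have := @measurable_fun_fubini_tonelli_F _ _ T1 T R P (EFin \o g)^\-%E (measurable_funeneg mgE) (fun=> funeneg_ge0 _ _).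
  by apply: eq_measurable_fun => x _; apply: eq_integral => y _; rewrite !funenegE.
Qed.

Lemma measurable_EK K phi : measurable_fun setT phi -> measurable_fun setT (EK K phi).
Proof.
move=> mphi; apply: (@measurable_param_Rintegral _ _ (phi \o mx K)).
exact: measurableT_comp mphi (measurable_mx K).
Qed.

(** The larger [K'] lets the conditional expectation given the strict past count as measurable for
    the present. [T1] is [T] with the smaller sigma-algebra. *)
Lemma measurable_EK_sub (K K' : pred nat) phi : (forall k, K k -> K' k) ->
  measurable_fun setT phi ->
  measurable_fun [set: g_sigma_algebraType (gen_sigma (fun k => X k : T -> S) [set k | K' k])]
    (EK K phi : g_sigma_algebraType _ -> R).
Proof.
move=> KK' mphi.
pose T1 := g_sigma_algebraType (gen_sigma (fun k => X k : T -> S) [set k | K' k]).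
apply: (@measurable_param_Rintegral _ T1 (fun z => phi (mixs K (traj z.1) (traj z.2)))).
apply: (@measurableT_comp _ _ _ _ _ _ phi _ (fun z : T1 * T => mixs K (traj z.1) (traj z.2))) => //.
apply: measurable_seqP => k; rewrite /mixs; case Kk : (K k).
- apply: (@measurableT_comp _ _ _ _ _ _ (fun w : T1 => X k w) _ fst) => //.
  move=> _ B mB; rewrite setTI; apply: sub_sigma_algebra; exists k; first exact: KK'.
  by exists B => //; rewrite setTI.
- exact: (@measurableT_comp _ _ _ _ _ _ (fun w : T => X k w) _ snd).
Qed.

Lemma EK_pair K phi (u : T -> R) : measurable_fun setT phi ->
  measurable_fun setT u ->
  P.-integrable setT (EFin \o (phi \o traj)) ->
  (P \x P)%E.-integrable setT (EFin \o (fun z => phi (mx K z) * u z.1)) ->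
  \int[P]_w (EK K phi w * u w) =
  \int[(P \x P)%E]_z (phi (mx K z) * u z.1).
Proof.
move=> mphi mu iphi ipair; rewrite -(Rintegral_inner ipair).
apply: ae_eq_Rintegral => //.
- by apply: measurable_funM; first exact: measurable_EK.
- exact: integrable_measurable_real (integrable_inner ipair).
- have := ae_inner_integrable (integrable_mx K mphi iphi).
  apply: filterS => w h _; symmetry.
  exact: (Rintegral_mulr (u w) h).
Qed.

Lemma EK_predT phi w : EK predT phi w = phi (traj w).
Proof.
exact: (Rintegral_prob_cst P (phi (traj w))).
Qed.

(** All identities between conditional expectations are instances: [L] is the complement of [K] for
    the defining property, the single index i for the orthogonality of martingale differences, and
    the indices beyond i for E[D_i F | F_i]. *)
Lemma EK_swap K L K' phi psi : measurable_fun setT phi -> measurable_fun setT psi ->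
  P.-integrable setT (EFin \o (phi \o traj)) ->
  (forall K, (P \x P)%E.-integrable setT
    (EFin \o (fun z => phi (mx K z) * psi (traj z.1)))) ->
  (forall x y, (forall k, ~~ L k -> x k = y k) -> psi x = psi y) ->
  (forall k, K k (+) L k = K' k) ->
  \int[P]_w (EK K phi w * psi (traj w)) = \int[P]_w (EK K' phi w * psi (traj w)).
Proof.
move=> mphi mpsi iphi ipair psiL KLK'.
have mpt := measurableT_comp mpsi measurable_traj.
rewrite (EK_pair mphi mpt iphi (ipair K)) (EK_pair mphi mpt iphi (ipair K')).
rewrite /= (pair_swap K mphi mpsi psiL).
by have -> : (fun k => K k (+) L k) = K' by apply/funext.
Qed.

Lemma Rintegral_restrict_traj (B : set SS) (h : T -> R) :
  \int[P]_(w in traj @^-1` B) h w = \int[P]_w (h w * \1_B (traj w)).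
Proof.
rewrite Rintegral_mkcond; apply: eq_Rintegral => w _; rewrite patchE indicE.
have [wB|wB] := boolP (traj w \in B).
- by rewrite ifT ?mulr1// inE; rewrite inE in wB.
- by rewrite ifF ?mulr0//; apply/negbTE; rewrite notin_setE; rewrite notin_setE in wB.
Qed.

Lemma integrable_pair_indic K phi (B : set SS) : measurable B ->
  measurable_fun setT phi -> P.-integrable setT (EFin \o (phi \o traj)) ->
  (P \x P)%E.-integrable setT (EFin \o (fun z => phi (mx K z) * \1_B (traj z.1))).
Proof.
move=> mB mphi iphi.
have mB1 : measurable_fun setT (\1_B : SS -> R) by exact: measurable_indic.
apply: (le_integrable_real measurableT _ _ (integrable_norm (integrable_mx K mphi iphi))).
- apply: measurable_funM; first exact: measurableT_comp mphi (measurable_mx K).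
  apply: (measurableT_comp mB1); exact: measurableT_comp measurable_traj measurable_fst.
- move=> z _; rewrite normrM /= ler_piMr//.
  by rewrite indicE; case: (_ \in _); rewrite ?normr1 ?normr0.
Qed.

Lemma EK_swap_setint K L K' phi (B : set SS) : measurable B ->
  measurable_fun setT phi -> P.-integrable setT (EFin \o (phi \o traj)) ->
  (forall x y : SS, (forall k, ~~ L k -> x k = y k) -> B x -> B y) ->
  (forall k, K k (+) L k = K' k) ->
  \int[P]_(w in traj @^-1` B) EK K phi w = \int[P]_(w in traj @^-1` B) EK K' phi w.
Proof.
move=> mB mphi iphi BL KL; rewrite !Rintegral_restrict_traj.
apply: (@EK_swap K L K' phi \1_B) => //.
- by move=> K0; exact: integrable_pair_indic.
- move=> x y xy; rewrite !indicE; congr ((nat_of_bool _)%:R).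
  by apply/idP/idP; rewrite !inE; apply: BL => k Lk; rewrite xy.
Qed.

Lemma cond_exp_EK (K : pred nat) phi : measurable_fun setT phi ->
  P.-integrable setT (EFin \o (phi \o traj)) ->
  is_cond_exp P (gen_sigma (fun k => X k : T -> S) [set k | K k]) (phi \o traj) (EK K phi).
Proof.
move=> mphi iphi; split.
- exact: measurable_EK_sub.
- exact: integrable_EK.
- move=> A mA.
  have mAT : d.-measurable A by exact: gen_sigma_measurable mA.
  have [B [mB KB AE]] := gen_sigma_preimage mA.
  rewrite !EFin_Rintegral//; last 2 first.
  + by apply: integrableS iphi.
  + by apply: integrableS (integrable_EK K mphi iphi).
  congr EFin; rewrite AE (@EK_swap_setint K (predC K) predT)//.
  + by apply: eq_Rintegral => w _; rewrite EK_predT.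
  + by move=> x y xy; apply: KB => k Kk; apply: xy; rewrite negbK.
  + by move=> k; rewrite /= addbN addbb.
Qed.

Lemma Rintegral_fst (g : T -> R) : P.-integrable setT (EFin \o g) ->
  \int[(P \x P)%E]_z g z.1 = \int[P]_w g w.
Proof.
move=> ig; rewrite -(Rintegral_inner (integrable_fst ig)).
by apply: eq_Rintegral => w _ /=; exact: (Rintegral_prob_cst P (g w)).
Qed.

Lemma Rintegral_mx K (phi : SS -> R) : measurable_fun setT phi ->
  P.-integrable setT (EFin \o (phi \o traj)) ->
  \int[(P \x P)%E]_z phi (mx K z) = \int[P]_w phi (traj w).
Proof.
move=> mphi iphi; rewrite -(Rintegral_fst iphi).
rewrite (@swap_Rintegral (predC K) (phi \o fst)); last first.
  exact: measurableT_comp mphi measurable_fst.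
apply: eq_Rintegral => z _; congr phi.
by apply/funext => k; rewrite /mx /sw /mixs /= negbK.
Qed.

(** * Approximation by finitely many coordinates *)

Definition L1 (psi : SS -> R) := measurable_fun setT psi /\
  P.-integrable setT (EFin \o (psi \o traj)).

(** The L^1 effect of resampling every coordinate from [n] on. Its vanishing in the limit plays the
    role of the convergence of E[psi(X) | X_k, k < n] to psi(X). *)
Definition mxerr n (psi : SS -> R) : R :=
  \int[(P \x P)%E]_z `|psi (mx (fun k => (k < n)%N) z) - psi (traj z.1)|.

Definition mxcvg psi := forall e, 0 < e ->
  exists N, forall n, (N <= n)%N -> mxerr n psi <= e.

Lemma L1B psi psi' : L1 psi -> L1 psi' -> L1 (fun x => psi x - psi' x).
Proof.
by move=> [m i] [m' i']; split; [exact: measurable_funB|exact: integrable_realB].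
Qed.

Lemma L1D psi psi' : L1 psi -> L1 psi' -> L1 (fun x => psi x + psi' x).
Proof.
by move=> [m i] [m' i']; split; [exact: measurable_funD|exact: integrable_realD].
Qed.

Lemma L1Z k psi : L1 psi -> L1 (fun x => k * psi x).
Proof.
by move=> [m i]; split; [exact: measurable_funM|exact: integrable_realZ].
Qed.

Lemma L1_norm psi : L1 psi -> L1 (fun x => `|psi x|).
Proof.
move=> [m i]; split; last exact: (integrable_norm i).
exact: measurableT_comp.
Qed.

Lemma L1_indic (B : set SS) : measurable B -> L1 \1_B.
Proof.
move=> mB; split; first exact: measurable_indic.
apply: (le_integrable_real measurableT _ _ (integrable_cst_real P 1)).
- by apply: measurableT_comp measurable_traj; exact: measurable_indic.
- by move=> x _; rewrite /= indicE; case: (_ \in _); rewrite ?normr1 ?normr0.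
Qed.

Lemma integrable_mxerr n psi : L1 psi -> (P \x P)%E.-integrable setT
  (EFin \o (fun z => `|psi (mx (fun k => (k < n)%N) z) - psi (traj z.1)|)).
Proof.
move=> [m i]; apply: integrable_norm.
by apply: integrable_realB => //; [exact: (integrable_mx _ m i)|exact: (integrable_fst i)].
Qed.

(** The factor 2 counts the mixture and the first copy, which both have the law of the original
    sequence. *)
Lemma mxerr_le n psi psi' : L1 psi -> L1 psi' ->
  mxerr n psi <= mxerr n psi' + 2 * \int[P]_w `|psi (traj w) - psi' (traj w)|.
Proof.
move=> L L'; have D := L1_norm (L1B L L').
have Dm := integrable_mx (fun k => (k < n)%N) (proj1 D) (proj2 D).
have Df := integrable_fst (proj2 D).
have -> : 2 * \int[P]_w `|psi (traj w) - psi' (traj w)| =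
  \int[(P \x P)%E]_z `|psi (mx (fun k => (k < n)%N) z) - psi' (mx (fun k => (k < n)%N) z)| +
  \int[(P \x P)%E]_z `|psi (traj z.1) - psi' (traj z.1)|.
  rewrite mulrDl mul1r; congr (_ + _).
  - by rewrite (Rintegral_mx _ (proj1 D) (proj2 D)).
  - by rewrite (Rintegral_fst (proj2 D)).
rewrite -RintegralD// -RintegralD//; last 2 first.
- exact: integrable_mxerr.
- exact: integrable_realD.
apply: le_Rintegral => //.
- exact: integrable_mxerr.
- by apply: integrable_realD => //; [exact: integrable_mxerr|exact: integrable_realD].
- move=> z _; set a := psi _; set b := psi _; set a' := psi' _; set b' := psi' _.
  have -> : a - b = (a' - b') + ((a - a') - (b - b')) by ring.
  by apply: le_trans (ler_normD _ _) _; rewrite lerD2l; exact: ler_normB.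
Qed.

Lemma mxcvg_approx psi : L1 psi ->
  (forall e, 0 < e -> exists psi', [/\ L1 psi', mxcvg psi' &
    \int[P]_w `|psi (traj w) - psi' (traj w)| <= e]) -> mxcvg psi.
Proof.
move=> L h e e0.
have e4 : 0 < e / 4 by rewrite divr_gt0.
have [psi' [L' cv d4]] := h _ e4.
have e2 : 0 < e / 2 by rewrite divr_gt0.
have [N hN] := cv _ e2; exists N => n Nn.
apply: le_trans (mxerr_le n L L') _.
have := hN n Nn; lra.
Qed.

Lemma mxcvgD psi psi' : L1 psi -> L1 psi' -> mxcvg psi -> mxcvg psi' ->
  mxcvg (fun x => psi x + psi' x).
Proof.
move=> L L' c c' e e0; have e2 : 0 < e / 2 by rewrite divr_gt0.
have [N hN] := c _ e2; have [N' hN'] := c' _ e2.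
exists (maxn N N') => n; rewrite geq_max => /andP[Nn Nn'].
have := hN n Nn; have := hN' n Nn' => h1 h2.
suff : mxerr n (fun x => psi x + psi' x) <= mxerr n psi + mxerr n psi' by lra.
rewrite /mxerr -RintegralD//; try exact: integrable_mxerr.
apply: le_Rintegral => //.
- exact: (integrable_mxerr n (L1D L L')).
- by apply: integrable_realD => //; exact: integrable_mxerr.
- by move=> z _; rewrite opprD addrACA; exact: ler_normD.
Qed.

Lemma mxcvgZ k psi : L1 psi -> mxcvg psi -> mxcvg (fun x => k * psi x).
Proof.
move=> L c e e0; have [|N hN] := c (e / (`|k| + 1)); first by rewrite divr_gt0// ltr_wpDl.
exists N => n Nn.
have -> : mxerr n (fun x => k * psi x) = `|k| * mxerr n psi.
  rewrite /mxerr -RintegralZl//; last exact: integrable_mxerr.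
  by apply: eq_Rintegral => z _; rewrite -mulrBr normrM.
have := hN n Nn; rewrite ler_pdivlMr ?ltr_wpDl//; apply: le_trans.
rewrite mulrC ler_wpM2l// ?lerDl//; apply: Rintegral_ge0 => //.
Qed.

Lemma mxcvg_cst c : mxcvg (fun=> c).
Proof.
move=> e e0; exists 0%N => n _; rewrite /mxerr subrr normr0.
by rewrite (Rintegral_prob_cst (P \x P)%E 0) ltW.
Qed.

Lemma ler_indicU (A B : set SS) x y :
  `|\1_(A `|` B) x - \1_(A `|` B) y| <= `|\1_A x - \1_A y| + `|\1_B x - \1_B y| :> R.
Proof.
rewrite !indicE !in_setU.
by case: (x \in A); case: (x \in B); case: (y \in A); case: (y \in B) => /=;
  rewrite ?subrr ?normr0 ?subr0 ?sub0r ?normrN ?normr1 ?addr0 ?add0r// ler_wpDl.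
Qed.

Lemma mxcvg_indicU (A B : set SS) : measurable A -> measurable B ->
  mxcvg \1_A -> mxcvg \1_B -> mxcvg \1_(A `|` B).
Proof.
move=> mA mB c c' e e0; have e2 : 0 < e / 2 by rewrite divr_gt0.
have [N hN] := c _ e2; have [N' hN'] := c' _ e2.
exists (maxn N N') => n; rewrite geq_max => /andP[Nn Nn'].
have := hN n Nn; have := hN' n Nn' => h1 h2.
have LA := L1_indic mA; have LB := L1_indic mB.
have LAB := L1_indic (measurableU _ _ mA mB).
suff : mxerr n \1_(A `|` B) <= mxerr n \1_A + mxerr n \1_B by lra.
rewrite /mxerr -RintegralD//; try exact: integrable_mxerr.
apply: le_Rintegral => //.
- exact: integrable_mxerr.
- by apply: integrable_realD => //; exact: integrable_mxerr.
- by move=> z _; exact: ler_indicU.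
Qed.

(** Finite unions increase to the whole union, so by continuity from below their indicators converge
    in L^1. *)
Lemma mxcvg_bigcup (F : nat -> set SS) : (forall k, measurable (F k)) ->
  (forall k, mxcvg \1_(F k)) -> mxcvg \1_(\bigcup_k F k).
Proof.
move=> mF cF.
pose G m := \big[setU/set0]_(i < m) F i.
have mG m : measurable (G m) by apply: bigsetU_measurable.
have cG m : mxcvg \1_(G m).
  elim: m => [|m IH].
    have := mxcvg_cst 0; congr mxcvg.
    by apply/funext => x; rewrite /G big_ord0 indicE in_set0.
  have -> : G m.+1 = G m `|` F m by rewrite /G big_ord_recr.
  by apply: mxcvg_indicU => //; have [] := CF m.
have mU : measurable (\bigcup_k F k) by exact: bigcupT_measurable.
have GU m : G m `<=` \bigcup_k F k.
  by rewrite /G -bigcup_mkord => x [k _ Fx]; exists k.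
have mt (B : set SS) : measurable B -> measurable (traj @^-1` B).
  by move=> mB; rewrite -[X in measurable X]setTI; exact: measurable_traj.
have pE (B : set SS) : measurable B -> \int[P]_w \1_B (traj w) = fine (P (traj @^-1` B)).
  by move=> mB; rewrite /Rintegral (integral_indic _ measurableT) ?setIT//; exact: mt.
apply: mxcvg_approx; first exact: L1_indic.
move=> e e0.
have cvgP : (P \o (fun m => traj @^-1` G m)) @ \oo --> P (traj @^-1` (\bigcup_k F k)).
  have -> : traj @^-1` (\bigcup_k F k) = \bigcup_m (traj @^-1` G m).
    apply/seteqP; split => [w [k _ Fk]|w [m _ Gm]]; last exact: GU Gm.
    by exists k.+1 => //; rewrite /G /= big_ord_recr; right.
  apply: nondecreasing_cvg_mu.
  - by move=> m; exact: mt.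
  - by apply: bigcupT_measurable => m; exact: mt.
  - move=> m m' mm'; apply/subsetPset => w; rewrite /G -!bigcup_mkord => -[k /= km Fk].
    by exists k => //=; exact: leq_trans mm'.
have cvgR : (fun m => fine (P (traj @^-1` G m))) @ \oo --> fine (P (traj @^-1` (\bigcup_k F k))).
  apply: (@fine_cvg _ _ _ _ (P \o (fun m => traj @^-1` G m))).
  by rewrite fineK//; exact: fin_num_measure (mt _ mU).
move/cvgrPdist_le : cvgR => /(_ _ e0)[N _ hN].
exists \1_(G N); split => //; first exact: L1_indic.
have := hN N (leqnn N); apply: le_trans; apply: le_trans (ler_norm _).
rewrite -!pE// -RintegralB//; last 2 first.
- exact: (proj2 (L1_indic mU)).
- exact: (proj2 (L1_indic (mG N))).
rewrite le_eqVlt; apply/orP; left; apply/eqP; apply: eq_Rintegral => w _.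
rewrite ger0_norm// subr_ge0 !indicE ler_nat.
by case: (boolP (_ \in G N)) => // /[!inE] /GU h; rewrite mem_set.
Qed.

(** The sets with this property form a sigma-algebra; an event on coordinate k belongs to it because
    its error is 0 for n > k. *)
Lemma mxcvg_indic (B : set SS) : measurable B -> mxcvg \1_B.
Proof.
pose C := [set B : set SS | measurable B /\ mxcvg \1_B].
suff : @measurable _ SS `<=` C by move=> h mB; have [] := h B mB.
apply: smallest_sub; first split.
- split => //; have := mxcvg_cst 0; congr mxcvg.
  by apply/funext => x; rewrite indicE in_set0.
- move=> A [mA cA]; rewrite setTD; split; first exact: measurableC.
  have LA := L1_indic mA.
  have h1 := mxcvgD (L1_indic measurableT) (L1Z (-1) LA).
  have : mxcvg (fun x => \1_setT x + -1 * \1_A x).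
    apply: h1; last exact: mxcvgZ.
    have := mxcvg_cst 1; congr mxcvg.
    by apply/funext => x; rewrite indicE in_setT.
  congr mxcvg; apply/funext => x; rewrite !indicE in_setT in_setC.
  by case: (x \in A); rewrite /= ?mulr1 ?mulr0 ?subrr ?addr0.
- move=> F CF; split; first by apply: bigcupT_measurable => k; case: (CF k).
  by apply: mxcvg_bigcup => k; case: (CF k).
- move=> _ [k _ [A mA <-]]; rewrite setTI; split.
    by rewrite -[X in measurable X]setTI; exact: measurable_coord.
  move=> e e0; exists k.+1 => n kn; rewrite /mxerr.
  rewrite [leLHS](_ : _ = \int[(P \x P)%E]_z (0 : R)).
    by rewrite (Rintegral_prob_cst (P \x P)%E 0) ltW.
  have AE (x : SS) : \1_((fun x : SS => x k) @^-1` A) x = \1_A (x k) :> R.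
    by rewrite !indicE; congr ((nat_of_bool _)%:R); apply/idP/idP; rewrite !inE.
  apply: eq_Rintegral => z _; rewrite !AE.
  have -> : mx (fun k => (k < n)%N) z k = traj z.1 k by rewrite /mx /mixs kn.
  by rewrite subrr normr0.
Qed.

Lemma mxcvg_sum (I : Type) (r : seq I) (psi : I -> SS -> R) :
  (forall i, L1 (psi i)) -> (forall i, mxcvg (psi i)) ->
  L1 (fun x => \sum_(i <- r) psi i x) /\ mxcvg (fun x => \sum_(i <- r) psi i x).
Proof.
move=> L c; elim: r => [|i r [L' c']].
  under eq_fun do rewrite big_nil; split; last exact: mxcvg_cst.
  by split => //; exact: integrable_cst_real.
under eq_fun do rewrite big_cons; split; first exact: L1D.
exact: mxcvgD.
Qed.

Import HBSimple.

Lemma mxcvg_sfun (g : {sfun SS >-> R}) : L1 g /\ mxcvg g.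
Proof.
have mg y : measurable (g @^-1` [set y]) by exact: measurable_sfunP.
have -> : (g : SS -> R) = (fun x => \sum_(i < #|` fset_set (range g)|)
    ((fset_set (range g))`_i * \1_(g @^-1` [set (fset_set (range g))`_i]) x)).
  by apply/funext => x; exact: fimfunEord.
apply: mxcvg_sum => i.
- by apply: L1Z; exact: L1_indic.
- by apply: mxcvgZ; [exact: L1_indic|exact: mxcvg_indic].
Qed.

(** Simple functions are dense in L^1 of the law of the sequence. *)
Lemma mxcvg_L1 psi : L1 psi -> mxcvg psi.
Proof.
move=> L; have [mpsi ipsi] := L; apply: mxcvg_approx => // e e0.
pose PY := @measure_function_pushforward__canonical__measure_function_Measure
  _ _ T SS R P _ measurable_traj.
have mE : measurable_fun setT (EFin \o psi) by exact/measurable_EFinP.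
have iY : PY.-integrable setT (EFin \o psi).
  by apply: (integrable_pushforward measurable_traj).
have [g [ig _ gl]] := approximation_sfun_integrable measurableT iY.
have gE n : (\int[PY]_x `|(EFin \o psi) x - (g n x)%:E| =
    (\int[P]_w `|psi (traj w) - g n (traj w)|)%:E)%E.
  have [Lg _] := mxcvg_sfun (g n).
  have [mD iD] := L1_norm (L1B L Lg).
  rewrite -EFin_Rintegral//.
  rewrite (@ge0_integral_pushforward _ _ _ _ _ _ measurable_traj P setT (fun x => `|(psi x - g n x)%:E|)%E)//.
  by apply: measurableT_comp => //; apply/measurable_EFinP; have [] := L1B L Lg.
have : (fun n => \int[P]_w `|psi (traj w) - g n (traj w)|) @ \oo --> (0 : R).
  apply: (@fine_cvg _ _ _ _ (fun n => (\int[P]_w `|psi (traj w) - g n (traj w)|)%:E)).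
  by rewrite -(funext gE).
move=> /cvgrPdist_le/(_ _ e0)[N _ /(_ N (leqnn N))].
rewrite sub0r normrN => h; have [Lg cg] := mxcvg_sfun (g N).
by exists (g N); split => //; apply: le_trans h; exact: ler_norm.
Qed.

Lemma sqint_mx K phi : measurable_fun setT phi -> sqint P (phi \o traj) ->
  sqint (P \x P)%E (phi \o mx K).
Proof.
move=> mphi [_ iphi]; split; first exact: measurableT_comp mphi (measurable_mx K).
apply: (@integrable_mx K (fun x => phi x ^+ 2)) => //.
exact: measurable_funX.
Qed.

Lemma sqint_fst (g : T -> R) : sqint P g -> sqint (P \x P)%E (fun z : T * T => g z.1).
Proof.
move=> [mg ig]; split; first exact: measurableT_comp mg measurable_fst.
exact: (integrable_fst ig).
Qed.

(** Conditional Jensen, section by section; where the integral of the squared section is infinite,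
    the bound is trivial. *)
Lemma sqint_EK K phi : measurable_fun setT phi -> sqint P (phi \o traj) ->
  sqint P (EK K phi).
Proof.
move=> mphi sphi; split; first exact: measurable_EK.
have [_ i2] := sqint_mx K mphi sphi.
apply: le_integrable (integrable_fubini_F i2) => //.
  by apply/measurable_EFinP; apply: measurable_funX; exact: measurable_EK.
move=> w _; rewrite /= ger0_norm ?sqr_ge0// gee0_abs; last first.
  by apply: integral_ge0 => w' _; rewrite lee_fin sqr_ge0.
rewrite /fubini_F /=.
set I := (\int[P]_y _)%E.
have [Ifin|] := boolP (I < +oo)%E; last by rewrite ltey negbK => /eqP ->; rewrite leey.
have mw : measurable_fun setT (fun w' => phi (mx K (w, w'))).
  apply: (measurableT_comp mphi).
  exact: measurableT_comp (measurable_mx K) (measurable_pair1 w).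
have sw : sqint P (fun w' => phi (mx K (w, w'))).
  split => //; apply/integrableP; split.
    by apply/measurable_EFinP; exact: measurable_funX.
  apply: le_lt_trans Ifin; rewrite le_eqVlt; apply/orP; left; apply/eqP.
  by apply: eq_integral => w' _ /=; rewrite ger0_norm// sqr_ge0.
rewrite /I EFin_Rintegral//; last by case: sw.
by rewrite lee_fin; exact: sqr_Rintegral_le.
Qed.

Lemma integrable_pair_sqint K phi (u : T -> R) : measurable_fun setT phi ->
  sqint P (phi \o traj) -> sqint P u ->
  (P \x P)%E.-integrable setT (EFin \o (fun z => phi (mx K z) * u z.1)).
Proof.
by move=> mphi sphi su; exact: (sqint_mul (sqint_mx K mphi sphi) (sqint_fst su)).
Qed.

(** The available convergence is in L^1, while [psi] is only square integrable: up to level c the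
    L^1 error suffices, and the tail of [psi] meets differences bounded in L^2. *)
Lemma EK_cvg phi psi e : measurable_fun setT phi -> measurable_fun setT psi ->
  sqint P (phi \o traj) -> sqint P (psi \o traj) -> 0 < e ->
  exists N, forall n, (N <= n)%N ->
    `|\int[P]_w (EK (fun k => (k < n)%N) phi w * psi (traj w)) -
      \int[P]_w (phi (traj w) * psi (traj w))| <= e.
Proof.
move=> mphi mpsi sphi spsi e0.
have iphi := sqint_integrable sphi.
pose V := \int[P]_w (phi (traj w) ^+ 2).
have V0 : 0 <= V by apply: Rintegral_ge0 => w _; exact: sqr_ge0.
(* Budget e/4 + e/2 + e/4: the L^1 error is at most e / (4 (c + 1)) and is multiplied by c; a^2 has
   integral at most 4 V, so eta a^2 costs at most e/2; the tail, at most e eta, is divided by 4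
   eta. *)
pose eta := e / (8 * (V + 1)).
have eta0 : 0 < eta by rewrite divr_gt0// mulr_gt0// ltr_wpDl.
have [c c0 tailc] := sqint_tail spsi (mulr_gt0 e0 eta0).
have c1 : 0 < e / (4 * (c + 1)) by rewrite divr_gt0// mulr_gt0// ltr_wpDl.
have [N hN] := mxcvg_L1 (conj mphi iphi) c1.
exists N => n Nn; have {hN} := hN n Nn; set m := mx (fun k => (k < n)%N).
move=> err.
pose a z := `|phi (m z) - phi (traj z.1)|.
pose b (w : T) := Num.max (`|psi (traj w)| - c) 0.
have mb : measurable_fun setT b.
  apply: measurable_maxr => //; apply: measurable_funB => //.
  by apply: measurableT_comp => //; exact: measurableT_comp mpsi measurable_traj.
have sb : sqint P b.
  apply: (le_sqint _ _ spsi) => // w; rewrite ger0_norm ?le_max ?lexx ?orbT//.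
  by rewrite ge_max normr_ge0 andbT lerBlDr lerDl.
have sphim := sqint_mx (fun k => (k < n)%N) mphi sphi.
have sphi1 := sqint_fst sphi.
have sd := sqintB sphim sphi1.
have sa : sqint (P \x P)%E a.
  apply: (le_sqint _ _ sd) => [|z]; last by rewrite normr_id.
  by apply: measurableT_comp => //; case: sd.
have intpair := @integrable_pair_sqint (fun k => (k < n)%N) phi (psi \o traj) mphi sphi spsi.
have ifst := integrable_fst (sqint_mul sphi spsi).
rewrite (EK_pair mphi (measurableT_comp mpsi measurable_traj) iphi intpair).
rewrite -(Rintegral_fst (sqint_mul sphi spsi)) -RintegralB//.
have idiff := integrable_realB measurableT intpair ifst.
apply: le_trans (le_normr_Rintegral measurableT idiff) _.
have ia := integrable_mxerr n (conj mphi iphi).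
have ia2 := proj2 sa; have ib2 := proj2 (sqint_fst sb).
have h1 := integrable_realZ measurableT c ia.
have h2 := integrable_realZ measurableT eta ia2.
have h3 := integrable_realZ measurableT (4 * eta)^-1 ib2.
(* AM-GM: a |psi| <= a (c + b) <= c a + eta a^2 + b^2 / (4 eta) *)
apply: (@le_trans _ _ (\int[(P \x P)%E]_z (c * a z + eta * a z ^+ 2 + (4 * eta)^-1 * b z.1 ^+ 2))).
  apply: le_Rintegral => //.
  - exact: integrable_norm idiff.
  - by apply: integrable_realD => //; exact: integrable_realD.
  - move=> z _; rewrite -mulrBl normrM -/(a z) /=.
    have psib : `|psi (traj z.1)| <= c + b z.1.
      by rewrite /b -lerBlDl le_max lexx.
    have a0 : 0 <= a z by exact: normr_ge0.
    apply: le_trans (ler_wpM2l a0 psib) _; rewrite mulrDr -addrA [c * _]mulrC lerD2l.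
    rewrite -subr_ge0.
    have -> : eta * a z ^+ 2 + (4 * eta)^-1 * b z.1 ^+ 2 - a z * b z.1 =
       (4 * eta)^-1 * (2 * eta * a z - b z.1) ^+ 2 by field; rewrite gt_eqF.
    by rewrite mulr_ge0 ?sqr_ge0// invr_ge0 mulr_ge0// ltW.
rewrite !RintegralD//; last exact: integrable_realD.
rewrite !RintegralZl// -/(mxerr n phi).
rewrite (Rintegral_fst (g := fun w => b w ^+ 2) (proj2 sb)).
have a2V : \int[(P \x P)%E]_z (a z ^+ 2) <= 4 * V.
  have i1 := proj2 sphim; have i2 := proj2 sphi1.
  have -> : 4 * V = \int[(P \x P)%E]_z (2 * (phi \o m) z ^+ 2 + 2 * (phi (traj z.1)) ^+ 2).
    rewrite RintegralD//; try exact: integrable_realZ.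
    rewrite !RintegralZl// (Rintegral_fst (proj2 sphi)).
    rewrite (@Rintegral_mx _ (fun x => phi x ^+ 2))//; last exact: (proj2 sphi).
      by rewrite /V /=; ring.
    exact: measurable_funX.
  apply: le_Rintegral => //.
  - by apply: integrable_realD => //; exact: integrable_realZ.
  - move=> z _; rewrite /a real_normK ?num_real//= -subr_ge0.
    have -> : 2 * phi (m z) ^+ 2 + 2 * phi (traj z.1) ^+ 2 - (phi (m z) - phi (traj z.1)) ^+ 2
      = (phi (m z) + phi (traj z.1)) ^+ 2 by ring.
    exact: sqr_ge0.
have b1 : c * mxerr n phi <= e / 4.
  apply: le_trans (ler_wpM2l c0 err) _.
  rewrite mulrA ler_pdivrMr ?mulr_gt0 ?ltr_wpDl//; nra.
have b2 : eta * \int[(P \x P)%E]_z (a z ^+ 2) <= e / 2.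
  apply: le_trans (ler_wpM2l (ltW eta0) a2V) _.
  rewrite /eta mulrAC ler_pdivrMr ?mulr_gt0 ?ltr_wpDl//; nra.
have b3 : (4 * eta)^-1 * \int[P]_w (b w ^+ 2) <= e / 4.
  have tail' : \int[P]_w (b w ^+ 2) <= e * eta by exact: tailc.
  have eta4 : 0 < 4 * eta by lra.
  rewrite (ler_pdivrMl _ _ eta4); apply: (le_trans tail').
  by rewrite le_eqVlt; apply/orP; left; apply/eqP; field.
lra.
Qed.

(** * Martingale differences and resampling of one coordinate *)

Local Notation le_ i := (fun k => (k <= i)%N).
Local Notation lt_ i := (fun k => (k < i)%N).
Local Notation ne_ i := (fun k => k != i).

Definition mdiff i phi w := EK (le_ i) phi w - EK (lt_ i) phi w.

Lemma sqint_mdiff i phi : measurable_fun setT phi -> sqint P (phi \o traj) ->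
  sqint P (mdiff i phi).
Proof. by move=> m s0; exact: sqintB (sqint_EK _ m s0) (sqint_EK _ m s0). Qed.

(** Exchanging coordinate i alone turns [le_ i] into [lt_ i] and leaves [psi] unchanged, so the two
    halves of [mdiff] have the same pairing with it. *)
Lemma mdiff_orth i phi psi : measurable_fun setT phi -> measurable_fun setT psi ->
  sqint P (phi \o traj) -> sqint P (psi \o traj) ->
  (forall x y, (forall k, k != i -> x k = y k) -> psi x = psi y) ->
  \int[P]_w (mdiff i phi w * psi (traj w)) = 0.
Proof.
move=> mphi mpsi sphi spsi psi_i.
rewrite /mdiff; under eq_Rintegral do rewrite mulrBl.
rewrite RintegralB//; last 2 first.
- exact: (sqint_mul (sqint_EK (le_ i) mphi sphi) spsi).
- exact: (sqint_mul (sqint_EK (lt_ i) mphi sphi) spsi).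
rewrite (@EK_swap (le_ i) (pred1 i) (lt_ i) phi psi) ?subrr//.
- exact: sqint_integrable.
- by move=> K; exact: (@integrable_pair_sqint K phi (psi \o traj)).
- by move=> k /=; rewrite ltn_neqAle; case: eqVneq => [->|_]; rewrite ?leqnn ?addbF.
Qed.

(** For a frozen second copy, [G] of the resampled sequence is a function of the first copy that
    ignores coordinate i. *)
Lemma mdiff_orth_mx i phi G : measurable_fun setT phi -> measurable_fun setT G ->
  sqint P (phi \o traj) -> sqint P (G \o traj) ->
  \int[(P \x P)%E]_z (mdiff i phi z.1 * G (mx (ne_ i) z)) = 0.
Proof.
move=> mphi mG sphi sG.
have sm := sqint_fst (sqint_mdiff i mphi sphi); have smx := sqint_mx (ne_ i) mG sG.
apply: (Rintegral_eq0_snd (sqint_mul sm smx)).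
have := ae_integrable2 (proj2 smx).
apply: filterS => w' iG /=.
pose psi x := G (mixs (ne_ i) x (traj w')).
have mpsi : measurable_fun setT psi.
  apply: (measurableT_comp mG).
  apply: (@measurableT_comp _ _ _ _ _ _ (fun p => mixs (ne_ i) p.1 p.2) _
    (fun x => (x, traj w'))); first exact: measurable_mixs.
  exact: measurable_pair2.
apply: (@mdiff_orth i phi psi) => //.
- by split; [exact: measurableT_comp mpsi measurable_traj|exact: iG].
- by move=> x y xy; congr G; apply/funext => k; rewrite /mixs; case: ifP => // /xy.
Qed.

(** D_i F as a function of the sequence, so that it can also be evaluated at the resampled
    sequence. *)
Definition Dtil i (phi : SS -> R) (x : SS) : R :=
  phi x - \int[P]_w' phi (mixs (ne_ i) x (traj w')).

Lemma measurable_Dtil i phi : measurable_fun setT phi -> measurable_fun setT (Dtil i phi).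
Proof.
move=> mphi; apply: measurable_funB => //.
apply: (@measurable_param_Rintegral _ SS (fun z => phi (mixs (ne_ i) z.1 (traj z.2)))).
apply: (measurableT_comp mphi).
apply: (@measurableT_comp _ _ _ _ _ _ (fun p => mixs (ne_ i) p.1 p.2) _
  (fun z : SS * T => (z.1, traj z.2))); first exact: measurable_mixs.
apply: measurable_fun_pair; first exact: measurable_fst.
exact: measurableT_comp measurable_traj measurable_snd.
Qed.

Lemma Dtil_traj i phi w : Dtil i phi (traj w) = phi (traj w) - EK (ne_ i) phi w.
Proof. by []. Qed.

Lemma sqint_Dtil i phi : measurable_fun setT phi -> sqint P (phi \o traj) ->
  sqint P (Dtil i phi \o traj).
Proof. by move=> m s0; exact: sqintB s0 (sqint_EK _ m s0). Qed.

(** The subtracted mean over coordinate i does not change when that coordinate is resampled. *)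
Lemma Dtil_diff i phi z :
  phi (traj z.1) - phi (mx (ne_ i) z) =
  Dtil i phi (traj z.1) - Dtil i phi (mx (ne_ i) z).
Proof.
rewrite /Dtil.
have -> : (fun w' => phi (mixs (ne_ i) (mx (ne_ i) z) (traj w'))) =
    (fun w' => phi (mixs (ne_ i) (traj z.1) (traj w'))).
  apply/funext => w'; congr phi; apply/funext => k; rewrite /mx /mixs.
  by case: (k != i).
by ring.
Qed.

Lemma EK_Dtil i phi : measurable_fun setT phi ->
  P.-integrable setT (EFin \o (phi \o traj)) ->
  {ae P, forall w, EK (ne_ i) (Dtil i phi) w = 0}.
Proof.
move=> mphi iphi.
have := ae_inner_integrable (integrable_mx (ne_ i) mphi iphi).
apply: filterS => w iw.
rewrite /EK /Dtil.
(* Resampling coordinate i twice is resampling it once, so the inner mean is constant in [w']. *)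
have -> : (fun w' => phi (mixs (ne_ i) (traj w) (traj w')) -
      \int[P]_w'' phi (mixs (ne_ i) (mixs (ne_ i) (traj w) (traj w')) (traj w''))) =
    (fun w' => phi (mx (ne_ i) (w, w')) - EK (ne_ i) phi w).
  apply/funext => w'; congr (_ - _); apply: eq_Rintegral => w'' _; congr phi.
  by apply/funext => k; rewrite /mixs; case: (k != i).
by rewrite RintegralB ?Rintegral_prob_cst ?subrr//; exact: integrable_cst_real.
Qed.

(** Conditional Jensen for the cube, section by section, in the extended reals since the third
    moment may be infinite. *)
Lemma cube_EK K phi : measurable_fun setT phi ->
  (\int[P]_w (`|EK K phi w| ^+ 3)%:E <= \int[P]_w (`|phi (traj w)| ^+ 3)%:E)%E.
Proof.
move=> mphi.
have m3 : measurable_fun setT (fun x => (`|phi x| ^+ 3)%:E).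
  by apply/measurable_EFinP; apply: measurable_funX; exact: measurableT_comp.
have m3z : measurable_fun setT (fun z => (`|phi (mx K z)| ^+ 3)%:E).
  exact: (measurableT_comp m3 (measurable_mx K)).
rewrite -(@ge0_integral_mx K _ m3); last by move=> x; rewrite lee_fin exprn_ge0.
rewrite (@fubini_tonelli1 _ _ _ _ _ P P _ m3z); last by move=> x; rewrite lee_fin exprn_ge0.
apply: ge0_le_integral => //.
- apply/measurable_EFinP; apply: measurable_funX.
  by apply: measurableT_comp => //; exact: measurable_EK.
- apply: (@measurable_fun_fubini_tonelli_F _ _ T T R P _ m3z) => x.
  by rewrite lee_fin exprn_ge0.
move=> w _; rewrite /fubini_F.
set I := (\int[P]_y _)%E.
have [Ifin|] := boolP (I < +oo)%E; last by rewrite ltey negbK => /eqP ->; rewrite leey.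
have mw : measurable_fun setT (fun w' => phi (mx K (w, w'))).
  apply: (measurableT_comp mphi).
  exact: measurableT_comp (measurable_mx K) (measurable_pair1 w).
have iw : P.-integrable setT (EFin \o (fun w' => `|phi (mx K (w, w'))| ^+ 3)).
  apply/integrableP; split.
    by apply/measurable_EFinP; apply: measurable_funX; exact: measurableT_comp.
  apply: le_lt_trans Ifin; rewrite le_eqVlt; apply/orP; left; apply/eqP.
  by apply: eq_integral => w' _ /=; rewrite ger0_norm// exprn_ge0.
rewrite /I EFin_Rintegral// lee_fin.
exact: (cube_Rintegral_le mw iw).
Qed.

(** * Arbitrary versions of D_i F and E[D_i F | F_i], and the bounds for one index *)

Section cond_exp_version.
Variables (i : nat) (phi : SS -> R) (D M : T -> R).
Hypotheses (mphi : measurable_fun setT phi) (sphi : sqint P (phi \o traj)).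
Hypothesis DE : is_frakD P (fun k => X k : T -> S) (phi \o traj) i D.
Hypothesis ME : is_cond_exp P (gen_sigma (fun k => X k : T -> S) [set k | (k <= i)%N]) D M.

Let iphi : P.-integrable setT (EFin \o (phi \o traj)).
Proof. exact: sqint_integrable. Qed.

Lemma integrable_frakD : P.-integrable setT (EFin \o D).
Proof.
have [E [_ iE _] ->] := DE.
exact: integrable_realB.
Qed.

Lemma frakD_ae : {ae P, forall w, D w = Dtil i phi (traj w)}.
Proof.
have [E cE ->] := DE.
have := cond_exp_unique (@gen_sigma_measurable _) cE (cond_exp_EK (ne_ i) mphi iphi).
by apply: filterS => w /= ->.
Qed.

Let mD : measurable_fun setT D.
Proof. exact: integrable_measurable_real integrable_frakD. Qed.

Let mDt : measurable_fun setT (Dtil i phi \o traj).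
Proof. by case: (sqint_Dtil i mphi sphi). Qed.

Lemma sqint_frakD : sqint P D.
Proof.
apply: ae_sqint (sqint_Dtil i mphi sphi) => //.
by apply: filterS frakD_ae => w ->.
Qed.

(** This form of [M] gives the Jensen bound on its third moment by that of D_i F; the form in
    [cond_exp_mdiff] gives the orthogonality. *)
Lemma cond_exp_Dtil : {ae P, forall w, M w = EK (le_ i) (Dtil i phi) w}.
Proof.
apply: (cond_exp_unique (@gen_sigma_measurable _) ME).
have [mE iE hE] := cond_exp_EK (le_ i) (measurable_Dtil i mphi)
  (sqint_integrable (sqint_Dtil i mphi sphi)).
split => // A mA; rewrite hE//.
have mAT : d.-measurable A by exact: gen_sigma_measurable mA.
apply: ae_eq_integral => //.
- by apply: measurable_funTS; exact/measurable_EFinP.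
- by apply: measurable_funTS; exact/measurable_EFinP.
- by apply: filterS frakD_ae => w h _ /=; rewrite h.
Qed.

(** Over an event of F_i, conditioning on all coordinates but i and conditioning on those before i
    give the same integral: the coordinates beyond i can be exchanged. *)
Lemma cond_exp_mdiff : {ae P, forall w, M w = mdiff i phi w}.
Proof.
apply: (cond_exp_unique (@gen_sigma_measurable _) ME).
have ile := integrable_EK (le_ i) mphi iphi.
have ilt := integrable_EK (lt_ i) mphi iphi.
have ine := integrable_EK (ne_ i) mphi iphi.
split.
- apply: measurable_funB; first exact: measurable_EK_sub.
  by apply: measurable_EK_sub => // k; exact: ltnW.
- exact: integrable_realB.
- move=> A mA.
  have mAT : d.-measurable A by exact: gen_sigma_measurable mA.
  have iA h : P.-integrable setT (EFin \o h) -> P.-integrable A (EFin \o h).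
    exact: integrableS.
  have [_ _ /(_ A mA)] := cond_exp_EK (le_ i) mphi iphi.
  rewrite !EFin_Rintegral//; try exact: iA; last first.
  + by apply: iA; exact: integrable_realB.
  + by apply: iA; exact: integrable_frakD.
  move=> [hle]; congr EFin.
  rewrite /mdiff (RintegralB mAT (iA _ ile) (iA _ ilt)).
  transitivity (\int[P]_(w in A) (phi (traj w) - EK (ne_ i) phi w)); last first.
    apply: ae_eq_Rintegral => //; try exact: measurable_funTS.
    by apply: filterS frakD_ae => w h _; rewrite h.
  rewrite (RintegralB mAT (iA _ iphi) (iA _ ine)).
  rewrite hle; congr (_ - _).
  have [B [mB KB ->]] := gen_sigma_preimage mA.
  apply/esym; apply: (@EK_swap_setint (ne_ i) (fun k => (i < k)%N) (lt_ i)) => //.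
  + by move=> x y xy; apply: KB => k ki; apply: xy; rewrite -leqNgt.
  + by move=> k; case: ltngtP.
Qed.

Let mM : measurable_fun setT M.
Proof. by case: ME => _ /integrable_measurable_real. Qed.

Lemma sqint_cond_exp : sqint P M.
Proof.
apply: ae_sqint (sqint_mdiff i mphi sphi) => //.
by apply: filterS cond_exp_mdiff => w ->.
Qed.

(** The almost sure identity of [M] with [mdiff] lives on one copy; integrating out the second copy
    and restoring it carries the orthogonality over to [M]. *)
Lemma cond_exp_orth_mx G : measurable_fun setT G -> sqint P (G \o traj) ->
  \int[(P \x P)%E]_z (G (mx (ne_ i) z) * M z.1) = 0.
Proof.
move=> mG sG; have iG := sqint_integrable sG.
have smd := sqint_mdiff i mphi sphi; have mmd := proj1 smd.
rewrite -(EK_pair mG mM iG); last exact: integrable_pair_sqint sqint_cond_exp.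
rewrite (@ae_eq_Rintegral _ _ _ P setT measurableT _ (fun w => EK (ne_ i) G w * mdiff i phi w)).
- rewrite (EK_pair mG mmd iG); last exact: integrable_pair_sqint.
  rewrite -[RHS](mdiff_orth_mx i mphi mG sphi sG).
  by apply: eq_Rintegral => z _; rewrite mulrC.
- by apply: measurable_funM => //; exact: measurable_EK.
- by apply: measurable_funM => //; exact: measurable_EK.
- by apply: filterS cond_exp_mdiff => w -> _.
Qed.

Local Notation F w := (phi (traj w)).
Local Notation F' z := (phi (mx (ne_ i) z)).

(** E_i F is the average of F' over the second copy, on which M k does not depend. *)
Lemma Rintegral_cond_exp_frakD (k : T -> R) : measurable_fun setT k ->
  sqint P (fun w => M w * k w) ->
  \int[P]_w (M w * D w * k w) =
  \int[(P \x P)%E]_z ((F z.1 - F' z) * (M z.1 * k z.1)).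
Proof.
move=> mk su; have [mu _] := su.
have iFu := sqint_mul sphi su.
have iF'u := integrable_pair_sqint (ne_ i) mphi sphi su.
rewrite (@ae_eq_Rintegral _ _ _ P setT measurableT _
  (fun w => F w * (M w * k w) - EK (ne_ i) phi w * (M w * k w))).
- rewrite RintegralB//; last exact: (sqint_mul (sqint_EK (ne_ i) mphi sphi) su).
  rewrite (EK_pair mphi mu iphi iF'u) -(Rintegral_fst iFu) -RintegralB//; last first.
    exact: (integrable_fst iFu).
  by apply: eq_Rintegral => z _; rewrite mulrBl.
- by apply: measurable_funM => //; exact: measurable_funM.
- apply: measurable_funB; apply: measurable_funM => //; last exact: measurable_EK.
  by case: sphi.
- apply: filterS frakD_ae => w -> _; rewrite Dtil_traj; ring.
Qed.

Let mFF' : measurable_fun setT (fun z => ((F z.1 - F' z) ^+ 2 * `|M z.1|)%:E).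
Proof.
apply/measurable_EFinP; apply: measurable_funM.
  apply: measurable_funX; apply: measurable_funB.
    apply: (measurableT_comp mphi); exact: measurableT_comp measurable_traj measurable_fst.
  exact: measurableT_comp mphi (measurable_mx _).
by apply: measurableT_comp => //; exact: measurableT_comp mM measurable_fst.
Qed.

(* As M is orthogonal to g(F'), the left-hand side is the mean of
   - M (g(F') - g(F) - g'(F) (F' - F)). *)
Lemma stein_term (g g' : R -> R) (c c' : R) :
  measurable_fun setT g -> measurable_fun setT g' ->
  (forall x y, `|g x - g y| <= c * `|x - y|) -> (forall x, `|g' x| <= c') ->
  (forall x y, `|g y - g x - g' x * (y - x)| <= (y - x) ^+ 2) ->
  (`|\int[P]_w (M w * g (F w)) - \int[P]_w (M w * D w * g' (F w))|%:E <=
  \int[(P \x P)%E]_z ((F z.1 - F' z) ^+ 2 * `|M z.1|)%:E)%E.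
Proof.
move=> mg mg' glip g'c taylor.
have mF : measurable_fun setT (phi \o traj) by case: sphi.
have mG : measurable_fun setT (g \o phi) by exact: measurableT_comp.
have sG : sqint P ((g \o phi) \o traj) := sqint_lip mg glip sphi.
have sM := sqint_cond_exp.
have c'0 : 0 <= c' := le_trans (normr_ge0 _) (g'c 0).
have su : sqint P (fun w => M w * g' (F w)).
  apply: (le_sqint _ _ (sqintZ c' sM)).
  - by apply: measurable_funM => //; exact: measurableT_comp mg' mF.
  - by move=> w; rewrite !normrM mulrC ler_wpM2r// (le_trans (g'c _))// ler_norm.
have iMG := sqint_mul sM sG.
have iG'M := integrable_pair_sqint (ne_ i) mG sG sM.
have iF'u := integrable_pair_sqint (ne_ i) mphi sphi su.
have iFu := integrable_fst (sqint_mul sphi su).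
have iFF' := integrable_realB measurableT iFu iF'u.
rewrite (Rintegral_cond_exp_frakD (measurableT_comp mg' mF) su).
pose h z := M z.1 * (g \o phi \o traj) z.1 - (g \o phi) (mx (ne_ i) z) * M z.1 -
  (F z.1 * (M z.1 * g' (F z.1)) - F' z * (M z.1 * g' (F z.1))).
have ih1 := integrable_realB measurableT (integrable_fst iMG) iG'M.
have ih : (P \x P)%E.-integrable setT (EFin \o h) := integrable_realB measurableT ih1 iFF'.
have -> : \int[P]_w (M w * g (F w)) -
    \int[(P \x P)%E]_z ((F z.1 - F' z) * (M z.1 * g' (F z.1))) = \int[(P \x P)%E]_z h z.
  rewrite /h (RintegralB measurableT ih1 iFF').
  rewrite (RintegralB measurableT (integrable_fst iMG) iG'M) (cond_exp_orth_mx mG sG) subr0.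
  rewrite (Rintegral_fst iMG); congr (_ - _).
  by apply: eq_Rintegral => z _; rewrite mulrBl.
rewrite EFin_normr_Rintegral//.
apply: le_trans (le_abse_integral _ _ _) _ => //; first by case/integrableP: ih.
apply: ge0_le_integral => //.
- by apply: measurableT_comp => //; case/integrableP: ih.
- move=> z _; rewrite lee_fin.
  have -> : h z = - (M z.1 * (g (F' z) - g (F z.1) - g' (F z.1) * (F' z - F z.1))).
    by rewrite /h /=; ring.
  rewrite normrN normrM mulrC ler_wpM2r//.
  by apply: le_trans (taylor _ _) _; rewrite -sqrrN opprB.
Qed.

Lemma resampled_mx w w' :
  resampled phi (fun k => X k : T -> S) i w w' = F' (w, w').
Proof.
congr phi; apply/funext => k; rewrite /mx /mixs.
by case: (k == i).
Qed.

(** The factor 2 undoes the 1/2 in the definition of [frakd]; the identity is Tonelli over the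
    second copy. *)
Lemma frakd_integral :
  measurable_fun setT
    (fun w => frakd P phi (fun k => X k : T -> S) i w ^+ 2 * `|M w|%:E)%E /\
  (2%:E * \int[P]_w (frakd P phi (fun k => X k : T -> S) i w ^+ 2 * `|M w|%:E) =
  \int[(P \x P)%E]_z ((F z.1 - F' z) ^+ 2 * `|M z.1|)%:E)%E.
Proof.
have FF'0 z : (0 <= ((F z.1 - F' z) ^+ 2 * `|M z.1|)%:E)%E.
  by rewrite lee_fin mulr_ge0// sqr_ge0.
pose q (z : T * T) := ((F z.1 - F' z) ^+ 2)%:E.
have q0 z : (0 <= q z)%E by rewrite lee_fin sqr_ge0.
have mq : measurable_fun setT q.
  apply/measurable_EFinP; apply: measurable_funX; apply: measurable_funB.
    by apply: (measurableT_comp mphi); exact: measurableT_comp measurable_traj measurable_fst.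
  exact: measurableT_comp mphi (measurable_mx _).
pose J w := (\int[P]_w' q (w, w'))%E.
have J0 w : (0 <= J w)%E by exact: integral_ge0.
have mJ : measurable_fun setT J := @measurable_fun_fubini_tonelli_F _ _ T T R P q mq q0.
have mMn : measurable_fun setT (fun w => `|M w|%:E).
  by apply/measurable_EFinP; exact: measurableT_comp.
have dE w : (frakd P phi (fun k => X k : T -> S) i w ^+ 2 * `|M w|%:E =
    (2^-1)%:E * (J w * `|M w|%:E))%E.
  rewrite /frakd sqr_sqrte; last first.
    by apply: mule_ge0 => //; apply: integral_ge0 => w' _; rewrite lee_fin sqr_ge0.
  rewrite muleA; congr (_ * _ * _)%E; apply: eq_integral => w' _.
  by rewrite /q resampled_mx /functional real_normK// num_real.
split; first by rewrite (funext dE); apply: emeasurable_funM => //; exact: emeasurable_funM.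
rewrite (@fubini_tonelli1 _ _ _ _ _ P P _ mFF' FF'0).
under eq_integral do rewrite dE.
rewrite -[LHS]ge0_integralZl//; last 2 first.
- apply: emeasurable_funM => //; exact: emeasurable_funM.
- by move=> w _; rewrite mule_ge0// mule_ge0.
apply: eq_integral => w _.
rewrite muleA -EFinM divff// mul1e /J /fubini_F -ge0_integralZr//.
exact: measurableT_comp mq (measurable_pair1 w).
Qed.

(* F - F' = x - y, where x and y are the values of Dtil at the original and at
   the resampled sequence. The cross term of (x - y)^2 |M| integrates to 0, as y
   is centered given the original sequence; Young's inequality bounds the other
   two terms. *)
Lemma frakd_integral_le :
  (\int[(P \x P)%E]_z ((F z.1 - F' z) ^+ 2 * `|M z.1|)%:E <=
  2%:E * \int[P]_w (`|D w| ^+ 3)%:E)%E.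
Proof.
pose dl := Dtil i phi.
have mdl : measurable_fun setT dl := measurable_Dtil i mphi.
have sdl : sqint P (dl \o traj) := sqint_Dtil i mphi sphi.
have m3 (k : T -> R) : measurable_fun setT k -> measurable_fun setT (fun w => `|k w| ^+ 3).
  by move=> mk; apply: measurable_funX; exact: measurableT_comp.
have n3 (k : T -> R) : (\int[P]_w `|(`|k w| ^+ 3)%:E| = \int[P]_w (`|k w| ^+ 3)%:E)%E.
  by apply: eq_integral => w _; rewrite gee0_abs// lee_fin exprn_ge0.
have -> : (\int[P]_w (`|D w| ^+ 3)%:E = \int[P]_w (`|dl (traj w)| ^+ 3)%:E)%E.
  apply: ae_eq_integral => //; try by apply/measurable_EFinP; exact: m3.
  by apply: filterS frakD_ae => w -> _.
have [fin|] := boolP (\int[P]_w (`|dl (traj w)| ^+ 3)%:E < +oo)%E; last first.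
  by rewrite ltey negbK => /eqP ->; rewrite gt0_muley ?leey// lte_fin.
have i3 : P.-integrable setT (EFin \o (fun w => `|dl (traj w)| ^+ 3)).
  by apply/integrableP; split; [apply/measurable_EFinP; exact: m3|rewrite n3].
have leM : (\int[P]_w (`|M w| ^+ 3)%:E <= \int[P]_w (`|dl (traj w)| ^+ 3)%:E)%E.
  apply: le_trans (cube_EK (le_ i) mdl).
  rewrite le_eqVlt; apply/orP; left; apply/eqP; apply: ae_eq_integral => //.
  - by apply/measurable_EFinP; exact: m3.
  - by apply/measurable_EFinP; apply: m3; exact: measurable_EK.
  - by apply: filterS cond_exp_Dtil => w -> _.
have iM3 : P.-integrable setT (EFin \o (fun w => `|M w| ^+ 3)).
  apply/integrableP; split; first by apply/measurable_EFinP; exact: m3.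
  by rewrite n3; exact: le_lt_trans leM fin.
move: leM; rewrite (EFin_Rintegral measurableT i3) (EFin_Rintegral measurableT iM3) lee_fin => leM.
have m3dl : measurable_fun setT (fun x => `|dl x| ^+ 3).
  by apply: measurable_funX; exact: measurableT_comp.
pose u w := dl (traj w) * `|M w|.
have mu : measurable_fun setT u.
  by apply: measurable_funM => //; exact: measurableT_comp.
have i3z := integrable_fst i3; have iM3z := integrable_fst iM3.
have i3mx := @integrable_mx (ne_ i) (fun x => `|dl x| ^+ 3) m3dl i3.
have isum := integrable_realD measurableT (integrable_realD measurableT i3z i3mx) iM3z.
have mdlmx : measurable_fun setT (fun z => dl (mx (ne_ i) z)).
  exact: measurableT_comp mdl (measurable_mx _).
have ix : (P \x P)%E.-integrable setT (EFin \o (fun z => dl (mx (ne_ i) z) * u z.1)).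
  apply: (le_integrable_real measurableT _ _ isum).
  - by apply: measurable_funM => //; exact: measurableT_comp mu measurable_fst.
  - move=> z _; rewrite /u !normrM normr_id.
    have := normr_ge0 (dl (traj z.1)); have := normr_ge0 (dl (mx (ne_ i) z)).
    have := normr_ge0 (M z.1); rewrite /=.
    set a := `|dl (traj z.1)|; set b := `|dl _|; set m := `|M _| => m0 b0 a0.
    (* Factored form of a^3 + b^3 + m^3 >= 3 a b m, up to a factor 2. *)
    have := mulr_ge0 (addr_ge0 (addr_ge0 a0 b0) m0)
      (addr_ge0 (addr_ge0 (sqr_ge0 (a - b)) (sqr_ge0 (b - m))) (sqr_ge0 (a - m))).
    have := mulr_ge0 (mulr_ge0 a0 b0) m0.
    by rewrite !exprS expr0 => h1 h2; nra.
have cross : \int[(P \x P)%E]_z (dl (mx (ne_ i) z) * u z.1) = 0.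
  rewrite -(EK_pair mdl mu (sqint_integrable sdl) ix).
  rewrite -[RHS](Rintegral_prob_cst P 0); apply: ae_eq_Rintegral => //.
  - by apply: measurable_funM => //; exact: measurable_EK.
  - by apply: filterS (EK_Dtil i mphi iphi) => w -> _; rewrite mul0r.
(* Each of the three cubes integrates to at most E|D_i F|^3, so the total is 2/3 times 3; the last
   term is the cross term, of integral 0. *)
pose B z := 2 / 3 * (`|dl (traj z.1)| ^+ 3 + `|dl (mx (ne_ i) z)| ^+ 3 + `|M z.1| ^+ 3)
  - 2 * (dl (mx (ne_ i) z) * u z.1).
have i1 := integrable_realZ measurableT (2 / 3) isum.
have i2 := integrable_realZ measurableT 2 ix.
have iB : (P \x P)%E.-integrable setT (EFin \o B) := integrable_realB measurableT i1 i2.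
apply: (@le_trans _ _ (\int[(P \x P)%E]_z (B z)%:E)%E); last first.
  rewrite (EFin_Rintegral measurableT iB) -EFinM lee_fin /B (RintegralB measurableT i1 i2).
  rewrite !RintegralZl// cross mulr0 subr0.
  rewrite (RintegralD measurableT (integrable_realD measurableT i3z i3mx) iM3z).
  rewrite (RintegralD measurableT i3z i3mx) (Rintegral_fst i3) (Rintegral_fst iM3).
  rewrite (@Rintegral_mx (ne_ i) (fun x => `|dl x| ^+ 3) m3dl i3) /=.
  by move: leM; set a := \int[P]_x _; set b := \int[P]_x _; lra.
apply: ge0_le_integral => //.
- by move=> z _; rewrite lee_fin mulr_ge0// sqr_ge0.
- by case/integrableP: iB.
move=> z _; rewrite lee_fin Dtil_diff -/dl /B /u.
set x := dl (traj z.1); set y := dl (mx (ne_ i) z); set m := `|M _|.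
have m0 : 0 <= m by exact: normr_ge0.
(* Equivalent to (2 a + m) (a - m)^2 >= 0 with a = |t|. *)
have yng t : t ^+ 2 * m <= 2 / 3 * `|t| ^+ 3 + m ^+ 3 / 3.
  rewrite -(real_normK (num_real t)); have := normr_ge0 t; set a := `|t| => a0.
  have := mulr_ge0 (addr_ge0 (addr_ge0 a0 a0) m0) (sqr_ge0 (a - m)).
  by rewrite !exprS expr0; lra.
have -> : (x - y) ^+ 2 * m = x ^+ 2 * m + y ^+ 2 * m - 2 * (y * (x * m)) by ring.
by rewrite lerD2r; have := yng x; have := yng y; lra.
Qed.

End cond_exp_version.

(** * The normal approximation bound *)

Section martingale_sum.
Variables (phi : SS -> R) (D M : nat -> T -> R) (Z : T -> R).
Hypotheses (mphi : measurable_fun setT phi) (sphi : sqint P (phi \o traj)).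
Hypothesis phi_mean : \int[P]_w phi (traj w) = 0.
Hypothesis DE : forall i, is_frakD P (fun k => X k : T -> S) (phi \o traj) i (D i).
Hypothesis ME : forall i,
  is_cond_exp P (gen_sigma (fun k => X k : T -> S) [set k | (k <= i)%N]) (D i) (M i).
Hypotheses (mZ : measurable_fun setT Z) (ZE : L1_sum P (fun i => D i \* M i) Z).
Local Notation F w := (phi (traj w)).

Lemma sum_mdiff n w : \sum_(0 <= i < n) mdiff i phi w = EK (lt_ n) phi w.
Proof.
rewrite /mdiff (telescope_sumr (fun i => EK (lt_ i) phi w) (leq0n n)).
(* [lt_ 0] is empty, so this conditional expectation is the mean. *)
by rewrite (_ : EK (lt_ 0) phi w = 0) ?subr0// -[RHS]phi_mean.
Qed.

Let sM i : sqint P (M i). Proof. exact: sqint_cond_exp mphi sphi (DE i) (ME i). Qed.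
Let sD i : sqint P (D i). Proof. exact: sqint_frakD mphi sphi (DE i). Qed.
Let iDM i : P.-integrable setT (EFin \o (fun w => D i w * M i w)).
Proof. exact: sqint_mul. Qed.

Lemma sum_cond_exp n psi : measurable_fun setT psi -> sqint P (psi \o traj) ->
  \sum_(0 <= i < n) \int[P]_w (M i w * psi (traj w)) =
  \int[P]_w (EK (lt_ n) phi w * psi (traj w)).
Proof.
move=> mpsi spsi.
under [RHS]eq_Rintegral do rewrite -sum_mdiff mulr_suml.
elim: n => [|n IH].
  rewrite big_nil; under eq_Rintegral do rewrite big_nil.
  by rewrite Rintegral_prob_cst.
rewrite big_nat_recr//= IH; under [RHS]eq_Rintegral do rewrite big_nat_recr//=.
have smd := sqint_mul (sqint_mdiff n mphi sphi) spsi.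
rewrite RintegralD//; last first.
  under eq_fun do rewrite -mulr_suml sum_mdiff.
  exact: sqint_mul (sqint_EK _ mphi sphi) spsi.
congr (_ + _); apply: ae_eq_Rintegral => //.
- exact: integrable_measurable_real (sqint_mul (sM n) spsi).
- exact: integrable_measurable_real smd.
- by apply: filterS (cond_exp_mdiff mphi sphi (DE n) (ME n)) => w ->.
Qed.

(** Convergence to 0 in the extended reals makes the expectations eventually finite, hence the
    differences integrable; the integrability of [Z] follows from this. *)
Lemma L1_sum_near e : 0 < e -> exists N, forall n, (N <= n)%N ->
  P.-integrable setT (EFin \o (fun w => \sum_(0 <= i < n) D i w * M i w - Z w)) /\
  \int[P]_w `|\sum_(0 <= i < n) D i w * M i w - Z w| <= e.
Proof.
move=> e0; have /fine_cvgP[fin /cvgrPdist_le/(_ _ e0) lim] := ZE.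
have [N _ NP] := filterI fin lim.
exists N => n /NP[/= fin_n lim_n].
have i1 : P.-integrable setT (EFin \o (fun w => \sum_(0 <= i < n) D i w * M i w - Z w)).
  apply/integrableP; split.
    apply/measurable_EFinP; apply: measurable_funB => //.
    apply: measurable_sum => i.
    exact: integrable_measurable_real (iDM i).
  by move: fin_n; rewrite unlock ge0_fin_numE//; exact: integral_ge0.
split => //; move: lim_n; rewrite sub0r normrN unlock; apply: le_trans; exact: ler_norm.
Qed.

Let isum n : P.-integrable setT (EFin \o (fun w => \sum_(0 <= i < n) D i w * M i w)).
Proof.
elim: n => [|n IH].
  by under eq_fun do rewrite big_nil; exact: integrable_cst_real.
under eq_fun do rewrite big_nat_recr//=.
exact: integrable_realD.
Qed.

Lemma integrable_L1_sum : P.-integrable setT (EFin \o Z).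
Proof.
have [N /(_ N (leqnn N))[iN _]] := L1_sum_near ltr01.
have := integrable_realB measurableT (isum N) iN.
by apply: eq_integrable => // w _ /=; congr EFin; rewrite opprB addrC subrK.
Qed.

Lemma L1_sum_test (k : T -> R) c e : measurable_fun setT k -> 0 <= c ->
  (forall w, `|k w| <= c) ->
  0 < e -> exists N, forall n, (N <= n)%N ->
  `|\sum_(0 <= i < n) \int[P]_w (M i w * D i w * k w) - \int[P]_w (Z w * k w)| <= e.
Proof.
move=> mk c0 kc e0.
have c1 : 0 < c + 1 by rewrite ltr_wpDl.
have bd f : P.-integrable setT (EFin \o f) ->
    P.-integrable setT (EFin \o (fun w => f w * k w)).
  move=> fi; apply: (le_integrable_real measurableT _ _
    (integrable_realZ measurableT c (integrable_norm fi))).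
  - by apply: measurable_funM => //; exact: integrable_measurable_real fi.
  - by move=> w _; rewrite normrM mulrC ler_wpM2r.
have [N NP] := L1_sum_near (divr_gt0 e0 c1).
exists N => n /NP[iN lN].
have -> : \sum_(0 <= i < n) \int[P]_w (M i w * D i w * k w) =
    \int[P]_w ((\sum_(0 <= i < n) D i w * M i w) * k w).
  elim: n {iN lN} => [|n IH].
    by rewrite big_nil; under eq_Rintegral do rewrite big_nil mul0r; rewrite Rintegral_prob_cst.
  rewrite big_nat_recr//= IH; under [RHS]eq_Rintegral do rewrite big_nat_recr//= mulrDl.
  rewrite (RintegralD measurableT (bd _ (isum n)) (bd _ (iDM n))).
  by congr (_ + _); apply: eq_Rintegral => w _; rewrite (mulrC (M n w)).
rewrite -(RintegralB measurableT (bd _ (isum n)) (bd _ integrable_L1_sum)).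
have iNk := bd _ iN.
under eq_Rintegral do rewrite -mulrBl.
apply: le_trans (le_normr_Rintegral measurableT iNk) _.
apply: (@le_trans _ _ (\int[P]_w (c * `|\sum_(0 <= i < n) D i w * M i w - Z w|))).
  apply: le_Rintegral => //; first exact: (integrable_norm iNk).
  - exact: (integrable_realZ measurableT c (integrable_norm iN)).
  - by move=> w _; rewrite normrM mulrC ler_wpM2r.
rewrite RintegralZl//; last exact: (integrable_norm iN).
apply: le_trans (ler_wpM2l c0 lN) _.
by rewrite mulrCA ger_pMr// ler_pdivrMr// mul1r lerDl.
Qed.

(** Replace D_i F by F - F'; then M_i is orthogonal to F'. *)
Lemma Rintegral_cond_exp_frakD1 i :
  \int[P]_w (M i w * D i w) = \int[P]_w (M i w * F w).
Proof.
have sM1 : sqint P (fun w => M i w * 1) by under eq_fun do rewrite mulr1.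
under eq_Rintegral do rewrite -[_ * _]mulr1.
rewrite (Rintegral_cond_exp_frakD mphi sphi (DE i) (ME i) (measurable_cst (1 : R)) sM1).
have iFM := integrable_fst (sqint_mul (sM i) sphi).
have iF'M := integrable_pair_sqint (ne_ i) mphi sphi (sM i).
rewrite -(Rintegral_fst (sqint_mul (sM i) sphi)).
rewrite -[RHS]subr0 -(cond_exp_orth_mx mphi sphi (DE i) (ME i) mphi sphi).
rewrite -(RintegralB measurableT iFM iF'M).
by apply: eq_Rintegral => z _ /=; ring.
Qed.

(** The partial sums have mean E[E[F | X_k, k < n] F], which tends to E[F^2]; L^1 convergence
    carries this over to [Z]. *)
Lemma mean_L1_sum : \int[P]_w Z w = \int[P]_w (F w ^+ 2).
Proof.
apply/eqP; rewrite -subr_eq0 -normr_le0; apply/ler_addgt0Pr => e e0; rewrite add0r.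
have e20 : 0 < e / 2 by rewrite divr_gt0.
have k1 (w : T) : `|1 : R| <= 1 by rewrite normr1.
have [N1 h1] := L1_sum_test (measurable_cst (1 : R)) ler01 k1 e20.
have [N2 h2] := EK_cvg mphi mphi sphi sphi e20.
have := h1 _ (leq_maxl N1 N2); have := h2 _ (leq_maxr N1 N2).
rewrite -(sum_cond_exp _ mphi sphi).
under eq_bigr do rewrite -Rintegral_cond_exp_frakD1.
under [X in _ -> `|X - _| <= _ -> _]eq_bigr do under eq_Rintegral do rewrite mulr1.
under [X in _ -> `|_ - X| <= _ -> _]eq_Rintegral do rewrite mulr1.
under [X in _ -> _ -> `|_ - X| <= _]eq_Rintegral do rewrite expr2.
set s := (\sum_(_ <= _ < _) _) => a b.
rewrite [e]splitr (_ : _ - _ = s - \int[P]_w (F w * F w) - (s - \int[P]_w Z w)); last by ring.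
by apply: le_trans (ler_normB _ _) _; exact: lerD.
Qed.

(** Both expectations are within e/2 of sums over i < n, which are compared term by term; the error
    terms are nonnegative, so their partial sum is at most the series. *)
Lemma stein_sum (g g' : R -> R) (c c' : R) :
  measurable_fun setT g -> measurable_fun setT g' ->
  (forall x y, `|g x - g y| <= c * `|x - y|) -> (forall x, `|g' x| <= c') ->
  (forall x y, `|g y - g x - g' x * (y - x)| <= (y - x) ^+ 2) ->
  (`|\int[P]_w (F w * g (F w)) - \int[P]_w (Z w * g' (F w))|%:E <=
  2%:E * \int[P]_w (\sum_(0 <= i <oo)
    frakd P phi (fun k => X k : T -> S) i w ^+ 2 * `|M i w|%:E))%E.
Proof.
move=> mg mg' glip g'c taylor.
have mF : measurable_fun setT (phi \o traj) by case: sphi.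
have mG : measurable_fun setT (g \o phi) by exact: measurableT_comp.
have sG : sqint P ((g \o phi) \o traj) := sqint_lip mg glip sphi.
have t0 i w : (0 <= frakd P phi (fun k => X k : T -> S) i w ^+ 2 * `|M i w|%:E)%E.
  by rewrite mule_ge0// expe_ge0// sqrte_ge0.
have fi i := frakd_integral mphi (ME i).
rewrite integral_nneseries//; last by move=> i; exact: (fi i).1.
rewrite -nneseriesZl//; last by move=> i _; exact: integral_ge0.
apply/lee_addgt0Pr => e e0.
have e20 : 0 < e / 2 by rewrite divr_gt0.
have mk : measurable_fun setT (fun w => g' (F w)) by exact: measurableT_comp mg' mF.
have c'0 : 0 <= c' := le_trans (normr_ge0 _) (g'c 0).
have [N1 h1] := L1_sum_test mk c'0 (fun w => g'c _) e20.
have [N2 h2] := EK_cvg mphi mG sphi sG e20.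
have := h1 _ (leq_maxl N1 N2); have := h2 _ (leq_maxr N1 N2).
rewrite -(sum_cond_exp _ mG sG); set n := maxn N1 N2.
set a := (\sum_(_ <= _ < _) _); set b := (\sum_(_ <= _ < _) _) => ha hb.
apply: (@le_trans _ _ (\sum_(0 <= i < n) 2%:E * \int[P]_w
   (frakd P phi (fun k => X k : T -> S) i w ^+ 2 * `|M i w|%:E) + e%:E)%E); last first.
  rewrite leeD2r//; apply: (nneseries_lim_ge n) => i _ _.
  by rewrite mule_ge0//; exact: integral_ge0.
apply: (@le_trans _ _ (`|a - b| + e)%:E).
  rewrite lee_fin [e]splitr; move: ha hb.
  rewrite !ler_norml /=; have := ler_norm (a - b); have := ler_norm (b - a).
  by rewrite distrC => ? ? /andP[? ?] /andP[? ?]; apply/andP; split; lra.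
rewrite EFinD leeD2r// /a /b -sumrB.
apply: (@le_trans _ _ (\sum_(0 <= i < n) `|\int[P]_w (M i w * (g \o phi) (traj w)) -
    \int[P]_w (M i w * D i w * g' (F w))|)%:E); first by rewrite lee_fin ler_norm_sum.
rewrite -sumEFin; apply: lee_sum => i _.
rewrite (fi i).2; exact: (stein_term mphi sphi (DE i) (ME i) mg mg' glip g'c taylor).
Qed.

Lemma sum_frakd_le :
  (2%:E * \int[P]_w (\sum_(0 <= i <oo)
    frakd P phi (fun k => X k : T -> S) i w ^+ 2 * `|M i w|%:E) <=
  2%:E * \sum_(0 <= i <oo) \int[P]_w (`|D i w| ^+ 3)%:E)%E.
Proof.
have t0 i w : (0 <= frakd P phi (fun k => X k : T -> S) i w ^+ 2 * `|M i w|%:E)%E.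
  by rewrite mule_ge0// expe_ge0// sqrte_ge0.
have fi i := frakd_integral mphi (ME i).
rewrite integral_nneseries//; last by move=> i; exact: (fi i).1.
rewrite -!nneseriesZl//; last 2 first.
- by move=> i _; apply: integral_ge0 => w _; rewrite lee_fin exprn_ge0.
- by move=> i _; exact: integral_ge0.
apply: lee_nneseries => i _; first by rewrite mule_ge0//; exact: integral_ge0.
by rewrite (fi i).2; exact: (frakd_integral_le mphi sphi (DE i) (ME i)).
Qed.

End martingale_sum.

End indep.

(** * The bound for one test function and the bound on E|1 - Z| *)

Section main_bound.
Context (d d' : measure_display) (R : realType) (T : measurableType d)
  (S : measurableType d') (P : probability T R) (X : nat -> {RV P >-> S}).
Hypothesis indepX : mutually_independent P (fun k => X k : T -> S).
Variables (f : seq_space S -> R) (D M : nat -> T -> R) (Z : T -> R).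
Let F : T -> R := functional f (fun k => X k : T -> S).
Hypotheses (mf : measurable_fun setT f) (sF : sqint P F) (F_mean : \int[P]_w F w = 0).
Hypothesis DE : forall i, is_frakD P (fun k => X k : T -> S) F i (D i).
Hypothesis ME : forall i,
  is_cond_exp P (gen_sigma (fun k => X k : T -> S) [set k | (k <= i)%N]) (D i) (M i).
Hypotheses (mZ : measurable_fun setT Z) (ZE : L1_sum P (fun i => D i \* M i) Z).

Let iZ : P.-integrable setT (EFin \o Z).
Proof. exact: (integrable_L1_sum indepX mf sF DE ME mZ ZE). Qed.

Let i1Z : P.-integrable setT (EFin \o (fun w => `|1 - Z w|)).
Proof.
exact: (integrable_norm (integrable_realB measurableT (integrable_cst_real P 1) iZ)).
Qed.

Lemma lip1_gap (h : R -> R) : (forall x y, `|h x - h y| <= `|x - y|) ->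
  (`|'E_P[h \o F] - (gmean h)%:E| <=
  (Num.sqrt (2 / pi))%:E * 'E_P[(fun w => `|1 - Z w|)%R] +
  2%:E * \int[P]_w (\sum_(0 <= i <oo)
    frakd P f (fun k => X k : T -> S) i w ^+ 2 * `|M i w|%:E))%E.
Proof.
move=> hl; pose g := stein_g h; pose g' := stein_dg h.
have [mF _] := sF; have iF := sqint_integrable sF.
have cg : continuous g.
  by move=> x; exact: is_derive_continuous (is_derive_stein_g hl x).
have mg : measurable_fun setT g by exact: continuous_measurable_fun.
have mg' : measurable_fun setT g'.
  by apply: continuous_measurable_fun; exact: continuous_stein_dg.
have mh : measurable_fun setT h.
  by apply: continuous_measurable_fun; exact: lip1_continuous.
have hl1 x y : `|h x - h y| <= 1 * `|x - y| by rewrite mul1r.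
have sh : sqint P (h \o F) := sqint_lip mh hl1 sF.
have ih := sqint_integrable sh.
have glip x y : `|g x - g y| <= 2 * gphi 0 * `|x - y| by exact: stein_g_lip.
have sg : sqint P (g \o F) := sqint_lip mg glip sF.
have iFg := sqint_mul sF sg.
have g'b x : `|g' x| <= 2 * gphi 0 by exact: stein_dg_bound.
have mg'F : measurable_fun setT (fun w => g' (F w)) by exact: measurableT_comp mg' mF.
have bd k : P.-integrable setT (EFin \o k) ->
    P.-integrable setT (EFin \o (fun w => k w * g' (F w))).
  move=> ki; apply: (le_integrable_real measurableT _ _
    (integrable_realZ measurableT (2 * gphi 0) (integrable_norm ki))).
  - by apply: measurable_funM => //; exact: integrable_measurable_real ki.
  - by move=> w _; rewrite normrM mulrC ler_wpM2r.
have iZg' := bd _ iZ.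
have i1g' := bd _ (integrable_cst_real P 1).
have i1Zg' := bd _ (integrable_realB measurableT (integrable_cst_real P 1) iZ).
have c2 : 2 * gphi 0 = Num.sqrt (2 / pi) :> R.
  have s2 : Num.sqrt 2 * Num.sqrt 2 = 2 :> R by rewrite -expr2 sqr_sqrtr.
  by rewrite gphi0E !sqrtrM// sqrtrV ?pi_ge0// invfM mulrA -{1}s2 mulfK// gt_eqF//.
have sE := stein_sum indepX mf sF F_mean DE ME mZ ZE mg mg' glip g'b (stein_taylor hl).
rewrite !expectation.unlock (EFin_Rintegral measurableT ih) (EFin_Rintegral measurableT i1Z).
rewrite -EFinB -EFinM.
(* Stein's equation at F, with E[Z g'(F)] subtracted and added back. *)
have -> : \int[P]_w (h \o F) w - gmean h =
    \int[P]_w ((1 - Z w) * g' (F w)) -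
    (\int[P]_w (F w * g (F w)) - \int[P]_w (Z w * g' (F w))).
  under [in RHS]eq_Rintegral do rewrite mulrBl.
  rewrite (RintegralB measurableT i1g' iZg').
  have -> : \int[P]_w (1 * g' (F w)) =
      \int[P]_w (F w * g (F w)) + (\int[P]_w (h \o F) w - gmean h).
    rewrite -[in RHS](Rintegral_prob_cst P (gmean h)).
    rewrite -(RintegralB measurableT ih (integrable_cst_real P _)).
    rewrite -(RintegralD measurableT iFg (integrable_realB measurableT ih (integrable_cst_real P _))).
    by apply: eq_Rintegral => w _; rewrite mul1r /g' /stein_dg addrA.
  by ring.
apply: (@le_trans _ _ (`|\int[P]_w ((1 - Z w) * g' (F w))| +
    `|\int[P]_w (F w * g (F w)) - \int[P]_w (Z w * g' (F w))|)%:E).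
  by rewrite lee_fin ler_normB.
rewrite EFinD; apply: leeD sE; rewrite lee_fin -c2.
apply: le_trans (le_normr_Rintegral measurableT i1Zg') _.
rewrite -RintegralZl//.
apply: le_Rintegral => //; first exact: (integrable_norm i1Zg').
  exact: (integrable_realZ measurableT _ i1Z).
by move=> w _; rewrite normrM mulrC ler_wpM2r.
Qed.

(** Triangle inequality through E[Z] = E[F^2], then Cauchy-Schwarz for Z - E[Z]; nothing is to be
    shown when the variance is infinite. *)
Lemma mean_dist_Z :
  ('E_P[(fun w => `|1 - Z w|)%R] <=
  `|1 - 'E_P[(fun w => F w ^+ 2)%R]| + sqrte ('V_P[Z]))%E.
Proof.
have mean := mean_L1_sum indepX mf sF F_mean DE ME mZ ZE.
have [_ iF2] := sF.
pose m := \int[P]_w Z w.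
have VE : ('V_P[Z] = \int[P]_w ((Z w - m) ^+ 2)%:E)%E.
  by rewrite /variance unlock unlock; apply: eq_integral => w _.
have iZm := integrable_realB measurableT iZ (integrable_cst_real P m).
have key : \int[P]_w `|1 - Z w| <= `|1 - m| + \int[P]_w `|Z w - m|.
  rewrite -[ `|1 - m| ](Rintegral_prob_cst P).
  rewrite -(RintegralD measurableT (integrable_cst_real P _) (integrable_norm iZm)).
  apply: le_Rintegral => //.
  - exact: (integrable_realD measurableT (integrable_cst_real P _) (integrable_norm iZm)).
  - by move=> w _ /=; rewrite (distrC (Z w)) -[1 - Z w](subrKA m) ler_normD.
rewrite VE !unlock (EFin_Rintegral measurableT i1Z) (EFin_Rintegral measurableT iF2).
rewrite -mean -EFinB -/m.
have V0 : (0 <= \int[P]_w ((Z w - m) ^+ 2)%:E)%E.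
  by apply: integral_ge0 => w _; rewrite lee_fin sqr_ge0.
have [fin|] := boolP (\int[P]_w ((Z w - m) ^+ 2)%:E < +oo)%E; last first.
  by rewrite ltey negbK => /eqP ->; rewrite addey ?leey.
have mZm : measurable_fun setT (fun w => Z w - m) by exact: measurable_funB.
have sZ : sqint P (fun w => `|Z w - m|).
  split; first exact: measurableT_comp.
  apply/integrableP; split.
    by apply/measurable_EFinP; apply: measurable_funX; exact: measurableT_comp.
  apply: le_lt_trans fin; rewrite le_eqVlt; apply/orP; left; apply/eqP.
  by apply: eq_integral => w _ /=; rewrite ger0_norm ?sqr_ge0// real_normK// num_real.
have VR : (\int[P]_w ((Z w - m) ^+ 2)%:E = (\int[P]_w (`|Z w - m| ^+ 2))%:E)%E.
  rewrite -(EFin_Rintegral measurableT (proj2 sZ)).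
  by apply: eq_integral => w _ /=; rewrite real_normK// num_real.
rewrite VR -EFinD lee_fin; apply: (le_trans key); rewrite lerD2l.
have I0 : 0 <= \int[P]_w `|Z w - m| by exact: Rintegral_ge0.
by rewrite -(ger0_norm I0) -sqrtr_sqr ler_wsqrtr//; exact: sqr_Rintegral_le.
Qed.

End main_bound.

Local Open Scope ereal_scope.

Theorem theorem3p1 (R : realType) (d d' d'' : measure_display)
    (T : measurableType d) (P : probability T R)
    (S : measurableType d') (X : nat -> {RV P >-> S})
    (indepX : mutually_independent P X)
    (f : {mfun seq_space S >-> R}) (F : T -> R) (FX : F = functional f X)
    (F_L2 : F \in Lfun P 2%:E) (F_mean : 'E_P[F] = 0)
    (D : nat -> T -> R) (DF : forall i, is_frakD P X F i (D i))
    (M : nat -> T -> R)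
    (MF : forall i,
      is_cond_exp P (gen_sigma X [set k | (k <= i)%N]) (D i) (M i))
    (Z : {RV P >-> R}) (ZF : L1_sum P (fun i => (D i \* M i)%R) Z)
    (U : measurableType d'') (Q : probability U R) (N : {RV Q >-> R})
    (N_std : forall A : set R, measurable A ->
      distribution Q N A = normal_prob 0%R 1%R A) :
  let B := (Num.sqrt (2 / pi))%:E * 'E_P[(fun w => `|1 - Z w|)%R]
    + 2%:E * \int[P]_w (\sum_(0 <= i <oo)
        frakd P f X i w ^+ 2 * `|M i w|%:E) in
  wasserstein P Q F N <= B
  /\ B <= (Num.sqrt (2 / pi))%:E * `|1 - 'E_P[F ^+ 2]|
    + (Num.sqrt (2 / pi))%:E * sqrte 'V_P[Z]
    + 2%:E * lyapunov_ratio P 3 D.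
Proof.
have mf : measurable_fun setT f by [].
have mF : measurable_fun setT F.
  by rewrite FX; apply: (measurableT_comp mf); exact: measurable_traj.
have sF : sqint P F.
  by split => //; exact: Lfun2_integrable_sqr.
have F0 : (\int[P]_w F w = 0)%R by rewrite /Rintegral; move: F_mean; rewrite unlock => ->.
have mZ : measurable_fun setT Z by [].
subst F.
move=> B; split.
- apply: ge_ereal_sup => _ [h hl <-].
  have [_ hN] := integral_std_normal hl N_std.
  have -> : 'E_Q[h \o N] = (gmean h)%:E by rewrite unlock.
  exact: (lip1_gap indepX mf sF F0 DF MF mZ ZF hl).
- rewrite /B -ge0_muleDr ?sqrte_ge0//.
  apply: leeD.
    rewrite lee_wpmul2l//.
    exact: (mean_dist_Z indepX mf sF F0 DF MF mZ ZF).
  (* [lyapunov_ratio] takes a real exponent; at 3 it agrees with the natural power of the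
     nonnegative base. *)
  have -> : lyapunov_ratio P 3 D = \sum_(0 <= i <oo) \int[P]_w (`|D i w| ^+ 3)%:E.
    rewrite /lyapunov_ratio; apply: eq_eseriesr => i _; rewrite unlock.
    by apply: eq_integral => w _; rewrite powR_mulrn.
  exact: (sum_frakd_le indepX mf sF DF MF).
Qed.
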